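(* Let $r,k\ge1$, $s_1,\dots,s_k\ge0$ be integers, $\Gamma$ the complete bipartite supernova quiver with these parameters, and $\boldsymbol\mu=(\mu^1,\dots,\mu^k)$ a $k$-tuple of nonzero partitions, $\mu^i=(\mu^i_1\ge\cdots\ge\mu^i_{s_i+1}\ge0)$, with $n_i:=|\mu^i|$ satisfying $r\geq n_i+\mu^i_1$ for all $i$. Then $$A_{\Gamma,\mathbf{v}_{\boldsymbol\mu}}(q)=\sum_{\mathbf{w}\in S_{\tilde{\boldsymbol\mu}}}R_{\mathbf{w}}(q).$$
   Context: $\Gamma$ has vertices $(l)$, $l=1,\dots,r$, and $(i;j)$, $i=1,\dots,k$, $j=0,\dots,s_i$; arrows: one arrow $(l)\to(i;0)$ for every $l,i$ and one arrow $(i;j)\to(i;j-1)$ for $1\le j\le s_i$. The dimension vector $\mathbf{v}_{\boldsymbol\mu}$ is $v_{(l)}=1$, $v_{(i;0)}=n_i$, $v_{(i;j)}=n_i-\sum_{f=1}^j\mu^i_f$. $A_{\Gamma,\mathbf{v}}(q)$ is the Kac polynomial: the number of isomorphism classes of absolutely indecomposable representations of $\Gamma$ of dimension vector $\mathbf{v}$ over $\mathbb{F}_q$. Set $\mu^i_0:=r-n_i$ and $\tilde\mu^i:=(\mu^i_0,\mu^i_1,\dots,\mu^i_{s_i+1})$. For a sequence $\mathbf{s}=(s'_1,\dots,s'_d)$ of nonnegative integers summing to $r$, partition $\{1,\dots,r\}$ into consecutive intervals (blocks) of sizes $s'_d,s'_{d-1},\dots,s'_1$ in this order from $1$ upward,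 and let $S_{r,\mathbf{s}}$ be the set of permutations $w\in S_r$ with $w^{-1}(a)<w^{-1}(b)$ whenever $a<b$ lie in the same block. Let $S_{\tilde{\boldsymbol\mu}}:=S_{r,\tilde\mu^1}\times\cdots\times S_{r,\tilde\mu^k}$. For $\mathbf{w}=(w_1,\dots,w_k)\in(S_r)^k$, the inversion graph $K_{\mathbf{w}}$ is the multigraph on vertices $1,\dots,r$ having, for each pair $j<i$ and each $t\in\{1,\dots,k\}$ with $w_t(i)<w_t(j)$, one edge joining $i$ and $j$ (of colour $t$). Define $R_{\mathbf{w}}(q):=\sum_{K}(q-1)^{e(K)-r+1}$, the sum over all connected spanning subgraphs $K$ of $K_{\mathbf{w}}$ (all $r$ vertices, a subset of the edges), where $e(K)$ is the number of edges of $K$; $R_{\mathbf{w}}(q)=0$ if $K_{\mathbf{w}}$ is disconnected. *)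

(* Defs.v *)
From mathcomp Require Import all_boot all_order all_algebra all_fingroup.
Set Implicit Arguments. Unset Strict Implicit. Unset Printing Implicit Defensive.
Import GRing.Theory.
Local Open Scope ring_scope.

Record quiver := Quiver {
  qvert : Type;
  qarr  : Type;
  qsrc  : qarr -> qvert;
  qtgt  : qarr -> qvert }.

Section Reps.
Variables (Q : quiver) (d : qvert Q -> nat).

(* A representation of Q of dimension vector d over a field L: a linear map
   V_{src a} -> V_{tgt a} for each arrow a, acting on row vectors
   (v |-> v *m A a), with V_x = L^(d x). *)
Definition qrep (L : fieldType) :=
  forall a : qarr Q, 'M[L]_(d (qsrc a), d (qtgt a)).

Definition qrep_iso (L : fieldType) (A B : qrep L) : Prop :=
  exists g : forall x : qvert Q, 'M[L]_(d x),
    (forall x, g x \in unitmx) /\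
    (forall a, A a *m g (qtgt a) = g (qsrc a) *m B a).

(* A is decomposable: V = U (+) W with U, W nonzero subrepresentations
   (subspaces given as row spaces of square matrices). *)
Definition qrep_decomposable (L : fieldType) (A : qrep L) : Prop :=
  exists U W : forall x : qvert Q, 'M[L]_(d x),
    (forall x, mxdirect (U x + W x) /\ (1%:M <= U x + W x)%MS) /\
    (forall a, (U (qsrc a) *m A a <= U (qtgt a))%MS /\
               (W (qsrc a) *m A a <= W (qtgt a))%MS) /\
    (exists x, U x != 0) /\ (exists x, W x != 0).

Definition qrep_indecomposable (L : fieldType) (A : qrep L) : Prop :=
  (exists x, 0 < d x)%N /\ ~ qrep_decomposable A.

Definition qrep_abs_indecomposable (F : fieldType) (A : qrep F) : Prop :=
  forall (L : closedFieldType) (f : {rmorphism F -> L}),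
    qrep_indecomposable (fun a => map_mx f (A a)).

Definition num_abs_indec_classes (F : fieldType) (N : nat) : Prop :=
  exists reps : 'I_N -> qrep F,
    (forall i, qrep_abs_indecomposable (reps i)) /\
    (forall i j, qrep_iso (reps i) (reps j) -> i = j) /\
    (forall A : qrep F, qrep_abs_indecomposable A ->
       exists i, qrep_iso A (reps i)).

End Reps.

(* vertices: inl l = (l), l < r ;  inr (i; j) with i < k, j <= s_i *)
Definition sn_vert (r k : nat) (s : 'I_k -> nat) : Type :=
  ('I_r + {i : 'I_k & 'I_(s i).+1})%type.

(* arrows: inl (l, i) : (l) -> (i;0) ;
           inr (i; j) with j < s_i : (i; j+1) -> (i; j) *)
Definition sn_arr (r k : nat) (s : 'I_k -> nat) : Type :=
  (('I_r * 'I_k) + {i : 'I_k & 'I_(s i)})%type.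

Definition sn_src (r k : nat) (s : 'I_k -> nat) (a : sn_arr r s) : sn_vert r s :=
  match a with
  | inl (l, _) => inl l
  | inr (existT i j) => inr (existT (fun i => 'I_(s i).+1) i (lift ord0 j))
  end.

Definition sn_tgt (r k : nat) (s : 'I_k -> nat) (a : sn_arr r s) : sn_vert r s :=
  match a with
  | inl (_, i) => inr (existT (fun i => 'I_(s i).+1) i ord0)
  | inr (existT i j) =>
      inr (existT (fun i => 'I_(s i).+1) i (widen_ord (leqnSn (s i)) j))
  end.

Definition supernova (r k : nat) (s : 'I_k -> nat) : quiver :=
  @Quiver (sn_vert r s) (sn_arr r s) (@sn_src r k s) (@sn_tgt r k s).

(* mu i = [:: mu^i_1; ...; mu^i_(s_i+1)] ;  n_i = sumn (mu i).
   v_(l) = 1,  v_(i;j) = n_i - (mu^i_1 + ... + mu^i_j). *)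
Definition sn_dim (r k : nat) (s : 'I_k -> nat) (mu : 'I_k -> seq nat)
    (x : qvert (supernova r s)) : nat :=
  match x with
  | inl _ => 1%N
  | inr (existT i j) => (sumn (mu i) - sumn (take j (mu i)))%N
  end.

(* a (0-indexed) lies in the c-th block of the consecutive blocks of sizes t *)
Definition in_block (t : seq nat) (c a : nat) : bool :=
  (sumn (take c t) <= a < sumn (take c.+1 t))%N.

Definition same_block (t : seq nat) (a b : nat) : bool :=
  has (fun c => in_block t c a && in_block t c b) (iota 0 (size t)).

(* S_{r, s'} for s' = (s'_1, ..., s'_d): blocks of sizes s'_d, ..., s'_1 from
   the bottom, i.e. block sizes rev s'. *)
Definition Sperm (r : nat) (s' : seq nat) : {set {perm 'I_r}} :=
  [set w : {perm 'I_r} | [forall a : 'I_r, forall b : 'I_r,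
     ((a < b)%N && same_block (rev s') a b) ==> ((w^-1)%g a < (w^-1)%g b)%N]].

Definition mutilde (r : nat) (m : seq nat) : seq nat := (r - sumn m)%N :: m.

Definition inv_edges (r k : nat) (w : {ffun 'I_k -> {perm 'I_r}})
  : {set 'I_r * 'I_r * 'I_k} :=
  [set e : 'I_r * 'I_r * 'I_k | (e.1.1 < e.1.2)%N && (w e.2 e.1.2 < w e.2 e.1.1)%N].

Definition edge_adj (r k : nat) (E : {set 'I_r * 'I_r * 'I_k}) : rel 'I_r :=
  fun x y => [exists t : 'I_k, ((x, y, t) \in E) || ((y, x, t) \in E)].

Definition connected_spanning (r k : nat) (E : {set 'I_r * 'I_r * 'I_k}) : bool :=
  [forall x : 'I_r, forall y : 'I_r, connect (edge_adj E) x y].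

(* R_w(q) = sum over connected spanning subgraphs K of (q-1)^(e(K)-r+1),
   evaluated at a natural number q >= 1 (exponent is >= 0 for connected K). *)
Definition Rw (r k : nat) (w : {ffun 'I_k -> {perm 'I_r}}) (q : nat) : nat :=
  \sum_(E : {set 'I_r * 'I_r * 'I_k} |
          (E \subset inv_edges w) && connected_spanning E)
     (q - 1) ^ (#|E|.+1 - r).

(* Main.v *)
Require Import Defs.
From mathcomp Require Import all_boot all_order all_algebra all_fingroup.
From mathcomp Require Import closed_field.
Set Implicit Arguments. Unset Strict Implicit. Unset Printing Implicit Defensive.
Import GRing.Theory.

(* An indecomposable representation has injective leg maps and surjective maps
   F^r -> V_(i;0), since otherwise an idempotent supported on a single leg splits
   off.  Bringing F^r -> V_(i;0) and then the leg maps one after the other into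
   reduced echelon form, with the last nonzero entry as pivot, labels a basis of
   V_(i;j) by a subset of {1,...,r}; these nested pivot sets amount to a
   permutation w_i in S_(r, mutilde^i), and the free entries of the echelon forms
   sit exactly at the inversions of w_i.  By uniqueness of echelon forms only the
   torus of diagonal r x r matrices is left to act.  It rescales the entry on an
   edge p - p' by the ratio of its coordinates at p and p', so the representation
   is indecomposable if and only if the edges with nonzero entry form a connected
   graph, and then its torus orbit has (q-1)^(r-1) elements. *)

(** * Idempotents and decomposability *)

(** Decompositions are handled as idempotent endomorphisms, because equations between matrices pass
    through isomorphisms and field extensions. This also settles the word absolutely. An absolutely
    indecomposable representation over [F] has no nontrivial idempotent over [F], and that alone
    brings it to a normal form with connected support. Conversely, base change keeps a normal form
    normal with the same support, so a connected support excludes idempotents over every extension.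
    Each inverted pair of a given colour is a free entry of one of the maps of that leg, so a single
    weight function on coloured edges records all the matrices. The arrows out of the sources run
    against the leg maps: there the transposed matrix is echelon, and its entries are inverted to
    make the torus act uniformly. No orbit is counted separately for each graph. A support [E]
    carries [(q-1)^e] weights with [e = #|E|], and every torus class has [(q-1)^(r-1)] elements; the
    quotient is the exponent [e-r+1] in [Rw]. *)

Section Splittings.
Local Open Scope ring_scope.
Variables (Q : quiver) (d : qvert Q -> nat) (L : fieldType).

Definition qrep_endo (A : qrep d L) (e : forall x, 'M[L]_(d x)) : Prop :=
  forall a, A a *m e (qtgt a) = e (qsrc a) *m A a.

Definition qrep_split (A : qrep d L) (e : forall x, 'M[L]_(d x)) : Prop :=
  [/\ forall x, e x *m e x = e x, qrep_endo A e,
      exists x, e x != 0 & exists x, e x != 1%:M].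

Lemma split_decomposable (A : qrep d L) e :
  qrep_split A e -> qrep_decomposable A.
Proof.
case=> idem endo [x ex] [y ey]; exists e, (fun x => 1%:M - e x); split.
  move=> z; split; last first.
    by rewrite -{1}[1%:M](subrK (e z)) addrC addmx_sub_adds.
  apply/mxdirect_addsP; set V := (_ :&: _)%MS.
  have /submxP[B VB] : (V <= e z)%MS by exact: capmxSl.
  have /submxP[C VC] : (V <= 1%:M - e z)%MS by exact: capmxSr.
  have Ve : V *m e z = V by rewrite VB -mulmxA idem.
  by rewrite -Ve VC -mulmxA mulmxBl mul1mx idem subrr mulmx0.
split.
  move=> a; split; first by rewrite -endo submxMl.
  by rewrite mulmxBl mul1mx -endo -{1}[A a]mulmx1 -mulmxBr submxMl.
split; first by exists x.
by exists y; rewrite subr_eq0 eq_sym.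
Qed.

Lemma decomposable_split (A : qrep d L) :
  qrep_decomposable A -> exists e, qrep_split A e.
Proof.
case=> U [W [UW [stab [[x Ux] [y Wy]]]]].
have dx z : (U z :&: W z = 0)%MS by case: (UW z) => /mxdirect_addsP.
have dx' z : (W z :&: U z = 0)%MS by rewrite capmxC.
have full z : (1%:M <= U z + W z)%MS by case: (UW z).
pose e z := proj_mx (U z) (W z); pose e' z := proj_mx (W z) (U z).
have ee' z : e z + e' z = 1%:M.
  by have := add_proj_mx (dx z) (full z); rewrite !mul1mx.
have eU z : (e z <= U z)%MS by rewrite -[e z]mul1mx proj_mx_sub.
have eW z : (e' z <= W z)%MS by rewrite -[e' z]mul1mx proj_mx_sub.
exists e; split.
- by move=> z; exact: proj_mx_proj.
- move=> a; have [sU sW] := stab a.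
  rewrite -[A a in LHS]mul1mx -(ee' (qsrc a)) !mulmxDl.
  rewrite (proj_mx_id (dx _)) ?(proj_mx_0 (dx _)) ?addr0 //.
    exact: submx_trans (submxMr _ (eW _)) sW.
  exact: submx_trans (submxMr _ (eU _)) sU.
- exists x; apply: contraNneq Ux => e0.
  by rewrite -(proj_mx_id (dx x) (submx_refl _)) -/(e x) e0 mulmx0.
- exists y; apply: contraNneq Wy => e1.
  by rewrite -[W y]mulmx1 -e1 (proj_mx_0 (dx y)).
Qed.

Lemma qrep_iso_trans (A B C : qrep d L) :
  qrep_iso A B -> qrep_iso B C -> qrep_iso A C.
Proof.
case=> g [gu gE] [h [hu hE]]; exists (fun x => g x *m h x); split.
  by move=> x; rewrite unitmx_mul gu hu.
by move=> a; rewrite mulmxA gE -mulmxA hE mulmxA.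
Qed.

Lemma split_iso (A B : qrep d L) e :
  qrep_iso A B -> qrep_split B e -> exists f, qrep_split A f.
Proof.
case=> g [gu gE] [idem endo [x ex] [y ey]].
exists (fun z => g z *m e z *m invmx (g z)); split.
- by move=> z; rewrite !mulmxA mulmxKV // -[_ *m e z *m e z]mulmxA idem.
- move=> a; apply: (can_inj (mulmxK (gu (qtgt a)))).
  rewrite !mulmxA mulmxKV // gE -(mulmxA (g _)) endo.
  by rewrite -[RHS]mulmxA gE !mulmxA mulmxKV.
- exists x; apply: contraNneq ex => e0.
  have : invmx (g x) *m (g x *m e x *m invmx (g x)) *m g x = 0.
    by rewrite e0 mulmx0 mul0mx.
  by rewrite -(mulmxA (g x)) mulKmx // mulmxKV // => ->.
- exists y; apply: contraNneq ey => e1.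
  have : invmx (g y) *m (g y *m e y *m invmx (g y)) *m g y = 1%:M.
    by rewrite e1 mulmx1 mulVmx.
  by rewrite -(mulmxA (g y)) mulKmx // mulmxKV // => ->.
Qed.

End Splittings.

Section ScalarExtension.
Local Open Scope ring_scope.
Variables (Q : quiver) (d : qvert Q -> nat).

(** One closed extension of [F] suffices: an idempotent over [F] stays different from 0 and 1 after
    the injective map into it. Countability of [F] provides this extension through
    [countable_algebraic_closure]. *)
Lemma abs_indecomposable_nsplit (F : countFieldType) (A : qrep d F) e :
  qrep_abs_indecomposable A -> ~ qrep_split A e.
Proof.
move=> absA [idem endo [x ex] [y ey]].
have [L [f _]] := countable_algebraic_closure F.
have [_ []] := absA L f; apply: (@split_decomposable _ _ _ _ (fun z => map_mx f (e z))).
split.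
- by move=> z; rewrite -map_mxM idem.
- by move=> a; rewrite -!map_mxM endo.
- by exists x; rewrite map_mx_eq0.
- by exists y; rewrite -(map_mx1 f) (inj_eq (@map_mx_inj _ _ f _ _)).
Qed.

End ScalarExtension.

(** * Idempotents of a chain of linear maps *)

Section Chains.
Local Open Scope ring_scope.
Variable L : fieldType.

(** A leg is indexed by all of [nat], with zero spaces beyond its end, so that dropping the first
    space leaves a chain again and inductions can shift. Nontriviality of [e] is stated separately
    where it is needed. *)
Definition chain_split (d : nat -> nat) (M : forall m, 'M[L]_(d m.+1, d m))
    (e : forall m, 'M[L]_(d m)) : Prop :=
  (forall m, e m *m e m = e m) /\ (forall m, M m *m e m = e m.+1 *m M m).

Lemma row_dual n (v : 'rV[L]_n) : v != 0 -> exists l : 'cV_n, v *m l = 1%:M.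
Proof.
case/rV0Pn=> j vj; exists ((v 0 j)^-1 *: delta_mx j 0).
rewrite -scalemxAr -colE; apply/matrixP=> a b.
by rewrite !ord1 !mxE mulVf.
Qed.

Lemma col_dual n (l : 'cV[L]_n) : l != 0 -> exists v : 'rV_n, v *m l = 1%:M.
Proof.
rewrite -trmx_eq0 => /row_dual[v E]; exists v^T.
by apply: trmx_inj; rewrite trmx_mul trmxK E trmx1.
Qed.

(** Pull the covector [l] back along the chain until its next pullback vanishes, choose there a
    vector pairing to 1 with it, and push this vector forward again. At each level covector times
    vector is a rank one idempotent; beyond, it is 0. The factor [l] in [e 0] lets whatever kills
    [l] kill [e 0]. *)
Lemma covector_split N (d : nat -> nat) (M : forall m, 'M[L]_(d m.+1, d m))
    (l : 'cV_(d 0%N)) :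
  (forall m, (N < m)%N -> d m = 0%N) -> l != 0 ->
  exists e u, [/\ chain_split M e, e 0%N = l *m u & u *m l = 1%:M].
Proof.
elim: N d M l => [|N IH] d M l dN l0.
  have [u ul] := col_dual l0.
  exists (fun m => match m return 'M_(d m) with 0 => l *m u | _ => 0 end), u.
  split=> //; split=> [[|m]|[|m]]; rewrite ?mulmx0 ?mul0mx //.
    by rewrite -mulmxA (mulmxA u) ul mul1mx.
  have d1 := dN 1%N isT.
  by apply/matrixP=> i; have := ltn_ord i; rewrite {2}d1.
have [Ml0|Ml0] := eqVneq (M 0%N *m l) 0.
  have [u ul] := col_dual l0.
  exists (fun m => match m return 'M_(d m) with 0 => l *m u | _ => 0 end), u.
  split=> //; split=> [[|m]|[|m]]; rewrite ?mulmx0 ?mul0mx //.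
    by rewrite -mulmxA (mulmxA u) ul mul1mx.
  by rewrite mulmxA Ml0 mul0mx.
have [|e [u [[idem endo] e0 ul]]] :=
  IH (fun m => d m.+1) (fun m => M m.+1) (M 0%N *m l) _ Ml0.
  by move=> m Nm; apply: dN.
exists (fun m => match m return 'M_(d m) with
                 | 0 => l *m (u *m M 0%N) | m'.+1 => e m' end), (u *m M 0%N).
split=> //; last by rewrite -mulmxA.
split=> [[|m]|[|m]] //=.
  by rewrite -mulmxA (mulmxA (u *m _)) -(mulmxA u) ul mul1mx.
by rewrite e0 !mulmxA.
Qed.

Lemma pushforward_chain b (d : nat -> nat) (M : forall m, 'M[L]_(d m.+1, d m))
    (u : 'rV_(d b)) :
  exists U : forall m, 'rV[L]_(d m),
    U b = u /\ forall m, (m < b)%N -> U m = U m.+1 *m M m.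
Proof.
elim: b d M u => [|b IH] d M u.
  by exists (fun m => match m return 'rV_(d m) with 0 => u | _ => 0 end).
have [U [Ub US]] := IH (fun m => d m.+1) (fun m => M m.+1) u.
exists (fun m => match m return 'rV_(d m) with
                 | 0 => U 0%N *m M 0%N | m'.+1 => U m' end).
by split=> // -[|m] // mb; apply: US.
Qed.

Fixpoint chain_comp (d : nat -> nat) (M : forall m, 'M[L]_(d m.+1, d m)) m :
    'M[L]_(d m, d 0%N) :=
  match m with 0 => 1%:M | m'.+1 => M m' *m chain_comp M m' end.

(** Dual to the covector case: lift [v] as far out as possible, to level [b], and choose a covector
    [l] with value 1 at [v] that kills the image of level [b.+1]. Maximality of [b] makes such an
    [l] exist, and its vanishing permits [e] to be 0 beyond [b]. *)
Lemma vector_split N (d : nat -> nat) (M : forall m, 'M[L]_(d m.+1, d m))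
    (v : 'rV_(d 0%N)) :
  (forall m, (N < m)%N -> d m = 0%N) -> v != 0 ->
  exists e l, [/\ chain_split M e, e 0%N = l *m v & v *m l = 1%:M].
Proof.
move=> dN v0; pose C := chain_comp M.
have ex0 : exists m, (v <= C m)%MS by exists 0%N; rewrite submx1.
have ub m : (v <= C m)%MS -> (m <= N)%N.
  rewrite leqNgt => vC; apply: contra v0 => /dN dm.
  suff C0 : C m = 0 by apply/eqP; move: vC; rewrite C0 => /submx0null.
  by apply/matrixP=> i; have := ltn_ord i; rewrite {2}dm.
case: (ex_maxnP ex0 ub) => b /submxP[u vu] bmax.
have : ~~ (v <= C b.+1)%MS by apply/negP => /bmax; rewrite ltnn.
rewrite submxE; move: (cokermx _) (mulmx_coker (C b.+1)) => K CK /rV0Pn[j vj].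
pose l := ((v *m K) 0 j)^-1 *: col j K.
have Cl : C b.+1 *m l = 0.
  by rewrite /l -scalemxAr colE (mulmxA (C _)) CK mul0mx scaler0.
have vl : v *m l = 1%:M.
  rewrite /l -scalemxAr; have -> : v *m col j K = col j (v *m K).
    by rewrite !colE mulmxA.
  move: (v *m K) vj => D vj; apply/matrixP=> a c.
  by rewrite !ord1 !mxE mulVf.
have [U [Ub US]] := pushforward_chain M u.
have UC m : (m <= b)%N -> U m *m C m = v.
  move=> mb; rewrite -(subKn mb); elim: (b - m)%N (leq_subr m b) => [|t IHt] tb.
    by rewrite subn0 Ub vu.
  have -> : U (b - t.+1)%N *m C (b - t.+1)%N =
            U (b - t.+1).+1 *m C (b - t.+1).+1.
    by rewrite US ?ltn_subrL ?(leq_trans _ tb) // -mulmxA.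
  by rewrite -subSn // subSS IHt // ltnW.
exists (fun m => if (m <= b)%N then C m *m l *m U m else 0), l.
split=> //; last by rewrite leq0n /= mul1mx -[U 0%N]mulmx1 (UC 0%N).
split=> m.
  case: leqP => [mb|_]; last by rewrite mulmx0.
  by rewrite mulmxA -(mulmxA _ (U m)) (mulmxA (U m)) UC // vl mulmx1.
have [mb|bm|->] := ltngtP m b.
- by rewrite US // !mulmxA.
- by rewrite mulmx0 mul0mx.
- by rewrite mul0mx 2!mulmxA -/(C b.+1) Cl mul0mx.
Qed.

(** A kernel vector of [M 0] is split off from the chain that starts at level 1. Since the
    idempotent at level 1 is [l *m v] and [v] dies under [M 0], it extends by 0 to level 0. Having
    [e 0 = 0], it is compatible with any maps entering level 0. *)
Lemma kernel_split N j (d : nat -> nat) (M : forall m, 'M[L]_(d m.+1, d m)) :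
  (forall m, (N < m)%N -> d m = 0%N) -> ~~ row_free (M j) ->
  exists e, [/\ chain_split M e, e 0%N = 0 & exists m, e m != 0].
Proof.
elim: j d M => [|j IH] d M dN Mj.
  move: Mj; rewrite -kermx_eq0 => /rowV0Pn[v /sub_kermxP vM v0].
  have [|e [l [[idem endo] e0 vl]]] :=
    vector_split (d := fun m => d m.+1) (N := N) (fun m => M m.+1) _ v0.
    by move=> m Nm; apply: dN; apply: ltnW.
  exists (fun m => match m return 'M_(d m) with 0 => 0 | m'.+1 => e m' end).
  split=> //.
    split=> [[|m]|[|m]] //=; first by rewrite mulmx0.
    by rewrite mulmx0 e0 -mulmxA vM mulmx0.
  exists 1%N; rewrite e0; apply: contraNneq v0 => lv.
  by rewrite -[v]mul1mx -vl -mulmxA lv mulmx0.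
have [|e [[idem endo] e0 [m em]]] :=
  IH (fun m => d m.+1) (fun m => M m.+1) _ Mj.
  by move=> m Nm; apply: dN; apply: ltnW.
exists (fun m => match m return 'M_(d m) with 0 => 0 | m'.+1 => e m' end).
split=> //; last by exists m.+1.
by split=> [[|i]|[|i]] //=; rewrite ?e0 ?mulmx0 ?mul0mx.
Qed.

End Chains.

(** * Echelon forms *)

Section Echelon.
Local Open Scope ring_scope.
Variable L : fieldType.

(* The pivots are those of an invertible maximal minor whose columns have the
   largest total weight: an entry beyond its pivot would allow an exchange. *)
Lemma echelon_exists a b (B : 'M[L]_(a, b)) (wt : 'I_b -> nat) : row_free B ->
  exists (f : 'I_a -> 'I_b) (h : 'M_a) (N : 'M_(a, b)),
    [/\ h \in unitmx, B = h *m N, forall c c', N c (f c') = (c == c')%:R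
      & forall c q, N c q != 0 -> (wt q <= wt (f c))%N].
Proof.
move=> freeB; pose P (f : {ffun 'I_a -> 'I_b}) := colsub f B \in unitmx.
have full : row_full B^T by rewrite /row_full mxrank_tr.
have Pf0 : P (fullrankfun full).
  rewrite /P; have -> : colsub (fullrankfun full) B = (rowsub (fullrankfun full) B^T)^T.
    by apply/matrixP=> i j; rewrite !mxE.
  by rewrite unitmx_tr fullrowsub_unit.
case: (arg_maxnP (fun f : {ffun 'I_a -> 'I_b} => \sum_c wt (f c))%N Pf0).
move=> f Pf fmax; set S := colsub f B; pose N := invmx S *m B.
have BN : B = S *m N by rewrite mulKVmx.
have Nf c c' : N c (f c') = (c == c')%:R.
  transitivity ((invmx S *m S) c c'); last by rewrite mulVmx // mxE.
  by rewrite !mxE; apply: eq_bigr => k _; rewrite mxE.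
exists f, S, N; split=> // c q Ncq; rewrite leqNgt; apply/negP => lt_fq.
pose f' := [ffun c0 => if c0 == c then q else f c0].
suff Pf' : P f'.
  have /= := fmax _ Pf'; rewrite leqNgt => /negP[].
  rewrite (bigD1 c) //= [ltnRHS](bigD1 c) //= ffunE eqxx -addSn leq_add //.
  by apply: leq_sum => c0 c0c; rewrite ffunE (negPf c0c).
(* After the factor [S], the exchanged minor is the identity with column [c] replaced by column [q]
   of [N]; its diagonal entry [N c q] is nonzero, so it is invertible. *)
have E : colsub f' B = S *m colsub f' N.
  rewrite {1}BN; apply/matrixP=> i j; rewrite !mxE.
  by apply: eq_bigr => k _; rewrite !mxE.
rewrite /P E unitmx_mul [S \in _]Pf -row_free_unit; apply: inj_row_free => v vN.
have vE c' : (v *m colsub f' N) 0 c' = \sum_k v 0 k * N k (f' c').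
  by rewrite mxE; apply: eq_bigr => k _; rewrite mxE.
have v0 c' : c' != c -> v 0 c' = 0.
  move=> c'c; have := vE c'; rewrite vN mxE ffunE (negPf c'c).
  rewrite (bigD1 c') //= Nf eqxx mulr1 big1 ?addr0 // => k kc.
  by rewrite Nf (negPf kc) mulr0.
apply/rowP=> c'; rewrite [RHS]mxE; have [->|/v0//] := eqVneq c' c.
have := vE c; rewrite vN mxE ffunE eqxx (bigD1 c) //= big1 ?addr0.
  by move/esym/eqP; rewrite mulf_eq0 (negPf Ncq) orbF => /eqP.
by move=> k kc; rewrite v0 // mul0r.
Qed.

End Echelon.

(** * Echelon matrices with labelled rows and columns *)

Section NormalForm.
Local Open Scope ring_scope.
Variables (L : fieldType) (r : nat).
Implicit Types (x : 'I_r -> 'I_r -> L) (t : 'I_r -> L).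

(* Coordinates are labelled by elements of 'I_r through phi and psi; the columns
   labelled by codom phi are the pivots. *)
Definition nf a b x (phi : 'I_a -> 'I_r) (psi : 'I_b -> 'I_r) : 'M[L]_(a, b) :=
  \matrix_(c, c') if psi c' \in codom phi then (phi c == psi c')%:R
                  else x (psi c') (phi c).

(** The torus element [t] on the span of the labels, written between two enumerations of them. Two
    enumerations are needed because a subspace determines its set of pivots but not their order. *)
Definition relabel a b t (phi : 'I_a -> 'I_r) (psi : 'I_b -> 'I_r) : 'M[L]_(a, b) :=
  \matrix_(c, c') if phi c == psi c' then t (phi c) else 0.

Lemma mul_relabel_r a b b' (A : 'M_(a, b)) t (psi : 'I_b -> 'I_r)
    (psi' : 'I_b' -> 'I_r) c c0 c' : injective psi -> psi c0 = psi' c' ->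
  (A *m relabel t psi psi') c c' = A c c0 * t (psi c0).
Proof.
move=> inj_psi E; rewrite mxE (bigD1 c0) //= mxE E eqxx big1 ?addr0 // => k kc0.
by rewrite mxE -E (inj_eq inj_psi) (negPf kc0) mulr0.
Qed.

Lemma mul_relabel_l a a' b (A : 'M_(a', b)) t (phi : 'I_a -> 'I_r)
    (phi' : 'I_a' -> 'I_r) c c0 c' : injective phi' -> phi c = phi' c0 ->
  (relabel t phi phi' *m A) c c' = t (phi c) * A c0 c'.
Proof.
move=> inj_phi E; rewrite mxE (bigD1 c0) //= mxE E eqxx big1 ?addr0 // => k kc0.
by rewrite mxE E (inj_eq inj_phi) eq_sym (negPf kc0) mul0r.
Qed.

Lemma relabel_unit a t (phi phi' : 'I_a -> 'I_r) :
  injective phi -> injective phi' -> codom phi =i codom phi' ->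
  (forall p, t p != 0) -> relabel t phi phi' \in unitmx.
Proof.
move=> inj1 inj2 E t0.
suff /mulmx1_unit[] :
    relabel t phi phi' *m relabel (fun p => (t p)^-1) phi' phi = 1%:M by [].
apply/matrixP=> c c'.
have /codomP[c0 Ec0] : phi c \in codom phi' by rewrite -E codom_f.
rewrite (mul_relabel_l _ _ _ inj2 Ec0) !mxE -Ec0 (inj_eq inj1).
by case: eqP; rewrite ?mulfV ?mulr0.
Qed.

Lemma nf_twist a b x x' t (phi phi' : 'I_a -> 'I_r) (psi psi' : 'I_b -> 'I_r) :
  injective phi' -> injective psi ->
  codom phi =i codom phi' -> codom psi =i codom psi' ->
  (forall p p', p \notin codom phi -> p \in codom psi -> p' \in codom phi ->
     x p p' * t p = t p' * x' p p') ->
  nf x phi psi *m relabel t psi psi' = relabel t phi phi' *m nf x' phi' psi'.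
Proof.
move=> inj1 inj2 E1 E2 H; apply/matrixP=> c c'.
have /codomP[c0 Ec0] : phi c \in codom phi' by rewrite -E1 codom_f.
have /codomP[c1 Ec1] : psi' c' \in codom psi by rewrite E2 codom_f.
rewrite (mul_relabel_l _ _ _ inj1 Ec0) (mul_relabel_r _ _ _ inj2 (esym Ec1)).
rewrite !mxE -Ec0 -Ec1 -E1; case: ifPn => Hc; last by apply: H; rewrite ?E2 ?codom_f.
by case: eqP => [->|]; rewrite ?mulr1 ?mul1r ?mulr0 ?mul0r.
Qed.

(** On the pivot columns [nf] is an identity matrix up to order, so these columns alone determine
    [h]; the other columns then give the relation between weights. No entry of [t] has to be
    invertible, so idempotents are covered too. *)
Lemma nf_stab a b x x' t (phi phi' : 'I_a -> 'I_r) (psi psi' : 'I_b -> 'I_r) h :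
  injective phi' -> injective psi ->
  codom phi =i codom phi' -> codom psi =i codom psi' ->
  {subset codom phi <= codom psi} ->
  nf x phi psi *m relabel t psi psi' = h *m nf x' phi' psi' ->
  h = relabel t phi phi' /\
  (forall p p', p \notin codom phi -> p \in codom psi -> p' \in codom phi ->
     x p p' * t p = t p' * x' p p').
Proof.
move=> inj1 inj2 E1 E2 sub E.
have hE : h = relabel t phi phi'.
  apply/matrixP=> c c1.
  have Hp : phi' c1 \in codom phi by rewrite E1 codom_f.
  have /codomP[c0 Ec0] := sub _ Hp.
  have /codomP[c' Ec'] : phi' c1 \in codom psi' by rewrite -E2 sub.
  move/matrixP/(_ c c'): E.
  rewrite (@mul_relabel_r _ _ _ _ _ _ _ _ c0) // -?Ec0 //.
  rewrite !mxE -Ec0 Hp (bigD1 c1) //= big1 ?addr0.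
    rewrite mxE -Ec' codom_f eqxx mulr1 => <-.
    by case: eqP => [->|]; rewrite ?mul1r ?mul0r.
  by move=> k kc1; rewrite mxE -Ec' codom_f (inj_eq inj1) (negPf kc1) mulr0.
split=> // p p' Hp /codomP[c0 Ec0] /codomP[c Ec].
have /codomP[c1 Ec1] : phi c \in codom phi' by rewrite -E1 codom_f.
have /codomP[c' Ec'] : psi c0 \in codom psi' by rewrite -E2 codom_f.
move/matrixP/(_ c c'): E; rewrite hE (mul_relabel_l _ _ _ inj1 Ec1).
rewrite (mul_relabel_r _ _ _ inj2 Ec') !mxE -Ec' -Ec1 -E1.
by rewrite -Ec0 -Ec (negPf Hp).
Qed.

(* The pivots are the positions of the last nonzero entries of vectors of the
   row space, hence they are determined by it. *)
Lemma nf_codom a b x x' t (phi phi' : 'I_a -> 'I_r) (psi psi' : 'I_b -> 'I_r) h :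
  injective phi' -> injective psi -> codom psi =i codom psi' ->
  {subset codom phi <= codom psi} -> {subset codom phi' <= codom psi'} ->
  (forall p, t p != 0) ->
  (forall p p', x p p' != 0 -> (p < p')%N) ->
  (forall p p', x' p p' != 0 -> (p < p')%N) ->
  h \in unitmx ->
  nf x phi psi *m relabel t psi psi' = h *m nf x' phi' psi' ->
  {subset codom phi <= codom phi'}.
Proof.
move=> inj1 inj2 E2 sub sub' t0 tri tri' hu E _ /codomP[c ->].
have nf_le (y : 'I_r -> 'I_r -> L) (f : 'I_a -> 'I_r) (g : 'I_b -> 'I_r) k l :
    (forall p p', y p p' != 0 -> (p < p')%N) -> nf y f g k l != 0 -> (g l <= f k)%N.
  move=> tri_y; rewrite mxE; case: ifP => _; last by move/tri_y/ltnW.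
  by case: (f k =P g l) => [->|]; rewrite ?eqxx.
have [k0 hk0] : exists k, h c k != 0.
  apply/existsP; apply: contraT; rewrite negb_exists => /forallP h0.
  have : row c h *m invmx h = row c 1%:M by rewrite -row_mul mulmxV.
  have -> : row c h = 0.
    by apply/rowP=> k; rewrite !mxE; apply/eqP; have := h0 k; rewrite negbK.
  by rewrite mul0mx => /rowP/(_ c)/eqP; rewrite !mxE eqxx eq_sym oner_eq0.
(* Row [c] of the two sides must end at the same position: on the left this is its pivot [phi c], on
   the right the largest pivot [phi' c1] whose coefficient in row [c] of [h] is nonzero. *)
case: (@arg_maxnP _ k0 (fun k => h c k != 0) (fun k => phi' k : nat) hk0).
move=> c1 hc1 c1max.
suff Epp : phi c = phi' c1 by rewrite Epp codom_f.
apply/val_inj/eqP; rewrite /= eqn_leq; apply/andP; split.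
- have Hp : phi c \in codom psi by apply: sub; rewrite codom_f.
  have /codomP[c0 Ec0] := Hp.
  have /codomP[c' Ec'] : phi c \in codom psi' by rewrite -E2.
  move/matrixP/(_ c c'): E; rewrite (@mul_relabel_r _ _ _ _ _ _ _ _ c0) -?Ec0 //.
  rewrite [nf x _ _ _ _]mxE -Ec0 codom_f eqxx mul1r [in RHS]mxE => Et.
  have [k /andP[hk nfk]] : exists k, (h c k != 0) && (nf x' phi' psi' k c' != 0).
    apply/existsP; apply: contraT; rewrite negb_exists => /forallP h0.
    have /eqP[] := t0 (phi c); rewrite Et big1 // => k _; apply/eqP.
    by rewrite mulf_eq0; have := h0 k; rewrite negb_and !negbK.
  by rewrite Ec'; apply: leq_trans (nf_le _ _ _ _ _ tri' nfk) (c1max _ hk).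
- have Hp : phi' c1 \in codom psi' by apply: sub'; rewrite codom_f.
  have /codomP[c' Ec'] := Hp.
  have /codomP[c0 Ec0] : phi' c1 \in codom psi by rewrite E2.
  move/matrixP/(_ c c'): E; rewrite (@mul_relabel_r _ _ _ _ _ _ _ _ c0) -?Ec0 //.
  rewrite [in RHS]mxE (bigD1 c1) //= big1 ?addr0; last first.
    by move=> k kc1; rewrite mxE -Ec' codom_f (inj_eq inj1) (negPf kc1) mulr0.
  rewrite [nf x' _ _ _ _]mxE -Ec' codom_f eqxx mulr1 => Et.
  have nfc : nf x phi psi c c0 != 0.
    by apply: contraNneq hc1 => n0; rewrite -Et n0 mul0r.
  by rewrite Ec0; apply: (nf_le _ _ _ _ _ tri nfc).
Qed.

(** The basis of level 0, given by [phi0] and [g0], is fixed; reducing [M 0 *m g0] chooses a basis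
    of level 1 labelled by its pivots, which is the starting basis for the shifted chain. *)
Lemma leg_normal_form N (d : nat -> nat) (M : forall m, 'M[L]_(d m.+1, d m))
    (phi0 : 'I_(d 0%N) -> 'I_r) (g0 : 'M_(d 0%N)) :
  (0 < r)%N -> injective phi0 -> g0 \in unitmx ->
  (forall m, (m < N)%N -> row_free (M m)) ->
  exists (phi : forall m, 'I_(d m) -> 'I_r) (g : forall m, 'M[L]_(d m)) x,
    [/\ phi 0%N = phi0, g 0%N = g0,
      forall m, (m < N)%N ->
        [/\ injective (phi m.+1), {subset codom (phi m.+1) <= codom (phi m)},
            g m.+1 \in unitmx & M m *m g m = g m.+1 *m nf x (phi m.+1) (phi m)]
    & forall p p', x p p' != 0 -> (p < p')%N /\ exists2 m, (m < N)%N &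
        [/\ p' \in codom (phi m.+1), p \in codom (phi m)
          & p \notin codom (phi m.+1)]].
Proof.
move=> r0; elim: N d M phi0 g0 => [|N IH] d M phi0 g0 inj0 gu free.
  exists (fun m => match m return 'I_(d m) -> 'I_r with
                   | 0 => phi0 | _ => fun _ => Ordinal r0 end),
         (fun m => match m return 'M_(d m) with 0 => g0 | _ => 1%:M end),
         (fun _ _ => 0).
  by split=> // p p'; rewrite eqxx.
have free0 : row_free (M 0%N *m g0).
  by rewrite /row_free mxrankMfree ?row_free_unit //; apply: free.
have [f [h [B [hu MB Bf Bmax]]]] :=
  echelon_exists (fun q => phi0 q : nat) free0.
have injf : injective f.
  move=> c c' ff; apply/eqP; have := Bf c c; rewrite ff Bf eqxx.
  by case: eqP => // _ /eqP; rewrite eq_sym oner_eq0.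
have injpf : injective (phi0 \o f) by apply: inj_comp.
have [|phi [g [x [phiE gE leg tri]]]] :=
  IH (fun m => d m.+1) (fun m => M m.+1) (phi0 \o f) h injpf hu.
  by move=> m mN; apply: free.
(* A non-pivot label leaves the nested pivot sets at this level for good, so its entries come from
   [B], while labels that survive belong to later levels. The double sum has at most one term, the
   entry with labels [p'] and [p]. *)
pose y p p' := if p \in codom (phi0 \o f) then x p p' else
  \sum_c \sum_(c' | (phi0 (f c) == p') && (phi0 c' == p)) B c c'.
have yE c c' : phi0 c' \notin codom (phi0 \o f) ->
    y (phi0 c') (phi0 (f c)) = B c c'.
  move=> nc; rewrite /y (negPf nc) (bigD1 c) //= [X in _ + X]big1 ?addr0.
    rewrite (bigD1 c') ?eqxx //= [X in _ + X]big1 ?addr0 // => k.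
    by rewrite !(inj_eq inj0) => /andP[->].
  move=> k kc; apply: big1 => c2.
  by rewrite (inj_eq inj0) (inj_eq injf) (negPf kc).
exists (fun m => match m return 'I_(d m) -> 'I_r with
                 | 0 => phi0 | m'.+1 => phi m' end),
       (fun m => match m return 'M_(d m) with 0 => g0 | m'.+1 => g m' end), y.
have nest m : (m <= N)%N -> {subset codom (phi m) <= codom (phi0 \o f)}.
  elim: m => [|m IHm] mN p; first by rewrite phiE.
  by have [_ sub _ _] := leg m mN => /sub/IHm; apply; apply: ltnW.
split=> //.
- move=> [|m] mN.
    rewrite phiE gE MB; split=> //.
      by move=> _ /codomP[c ->]; apply: codom_f.
    congr (_ *m _); apply/matrixP=> c c'; rewrite mxE.
    case: ifPn => [/codomP[c1]|nc]; last by rewrite /= yE.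
    by move=> /= /inj0 ->; rewrite Bf !(inj_eq inj0, inj_eq injf).
  have [inj sub gu' E] := leg m mN; split=> //; rewrite E; congr (_ *m _).
  apply/matrixP=> c c'; rewrite !mxE; case: ifP => // _.
  by rewrite /y (nest m) ?codom_f // ltnW.
- move=> p p'; rewrite /y; case: ifPn => [pc /tri|pnc].
    by case=> lt [m mN H]; split=> //; exists m.+1.
  move=> Sn0.
  have [c [c' /and3P[/eqP Ep' /eqP Ep Bn0]]] : exists c c',
      [&& phi0 (f c) == p', phi0 c' == p & B c c' != 0].
    have [c Hc] : exists c, \sum_(c' | (phi0 (f c) == p') && (phi0 c' == p)) B c c' != 0.
      apply/existsP; apply: contraT; rewrite negb_exists => /forallP h0.
      by rewrite big1 ?eqxx // in Sn0 => k _; apply/eqP; have := h0 k; rewrite negbK.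
    have [c' Hc'] : exists c', [&& phi0 (f c) == p', phi0 c' == p & B c c' != 0].
      apply/existsP; apply: contraT; rewrite negb_exists => /forallP h0.
      rewrite big1 ?eqxx // in Hc => k /andP[/eqP E1 /eqP E2].
      by apply/eqP; have := h0 k; rewrite E1 E2 !eqxx negbK.
    by exists c, c'.
  have le : (p <= p')%N by rewrite -Ep -Ep'; apply: Bmax.
  have p'c : p' \in codom (phi0 \o f) by rewrite -Ep'; apply: codom_f.
  split.
    rewrite ltn_neqAle le andbT; apply: contra pnc => /eqP/val_inj->.
    exact: p'c.
  by exists 0%N; rewrite // phiE -{1}Ep codom_f; split.
Qed.

End NormalForm.

(** * Blocks and inversions *)

Section LegDimensions.
Variable mu : seq nat.

Definition leg_dim (m : nat) : nat := sumn mu - sumn (take m mu).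

Lemma leg_dim_drop m : leg_dim m = sumn (drop m mu).
Proof. by rewrite /leg_dim -{1}(cat_take_drop m mu) sumn_cat addKn. Qed.

Lemma leg_dim0 : leg_dim 0 = sumn mu.
Proof. by rewrite leg_dim_drop drop0. Qed.

Lemma leg_dim_anti m m' : m <= m' -> leg_dim m' <= leg_dim m.
Proof.
move=> mm'; rewrite leq_sub2l // -(subnKC mm') takeD sumn_cat; exact: leq_addr.
Qed.

Lemma leg_dim_oversize m : size mu <= m -> leg_dim m = 0.
Proof. by move=> H; rewrite leg_dim_drop drop_oversize. Qed.

End LegDimensions.

Section Blocks.
Variables (r : nat) (mu : seq nat).
Hypotheses (mu_nil : 0 < size mu) (mu_r : sumn mu <= r).
Let d := leg_dim mu.

Lemma leg_dim_le m : d m <= r.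
Proof. by apply: leq_trans mu_r; rewrite -leg_dim0 leg_dim_anti. Qed.

(** Read from the bottom, the block sizes are the parts of [mu] from last to first, then
    [r - sumn mu]. Their partial sums are tails of [mu], so the block boundaries are the dimensions
    along the leg. *)
Lemma block_start c : c <= size mu ->
  sumn (take c (rev (mutilde r mu))) = d (size mu - c).
Proof.
move=> cs; rewrite /mutilde rev_cons -cats1 takel_cat ?size_rev //.
by rewrite take_rev sumn_rev /d leg_dim_drop.
Qed.

Lemma block_end : sumn (take (size mu).+1 (rev (mutilde r mu))) = r.
Proof.
rewrite take_oversize ?size_rev // sumn_rev /mutilde /=.
by rewrite subnK.
Qed.

Lemma same_blockP (a b : nat) : a < r -> b < r ->
  reflect (forall m, m < size mu -> (a < d m) = (b < d m))
          (same_block (rev (mutilde r mu)) a b).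
Proof.
move=> ar br; apply: (iffP hasP).
  case=> c; rewrite mem_iota size_rev /= ltnS => cs.
  rewrite /in_block => /andP[/andP[a1 a2] /andP[b1 b2]] m ms.
  rewrite block_start // in a1 b1.
  have [le|gt] := leqP (size mu - c) m.
    by rewrite !ltnNge !(leq_trans (leg_dim_anti mu le)).
  have cs' : c < size mu.
    by move: gt; rewrite ltn_subRL; apply: leq_ltn_trans (leq_addr _ _).
  rewrite block_start // in a2 b2.
  have le : m <= size mu - c.+1 by rewrite subnS -ltnS prednK // (leq_ltn_trans _ gt).
  by rewrite (leq_trans a2) ?(leq_trans b2) ?leg_dim_anti.
(* Values from [d 0] on form the top block, of size [r - sumn mu]; any other value lies in the block
   between [d m.+1] and [d m] for the largest [m] with [a < d m]. *)
move=> H; case: (ltnP a (d 0)) => a0; last first.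
  exists (size mu); first by rewrite mem_iota size_rev /= ltnS leqnn.
  rewrite /in_block block_end block_start // subnn a0 ar br /= andbT.
  by rewrite leqNgt -H // -leqNgt.
have ex0 : exists m, (m < size mu) && (a < d m) by exists 0; rewrite mu_nil.
have ub m : (m < size mu) && (a < d m) -> m <= size mu by case/andP=> /ltnW.
case: (ex_maxnP ex0 ub) => m /andP[ms am] mmax.
have S : size mu - (size mu - m.+1) = m.+1 by rewrite subKn.
have le_start x : x < r -> (forall m, m < size mu -> (a < d m) = (x < d m)) ->
    (d m.+1 <= x) && (x < d m).
  move=> xr Hx; rewrite -Hx // am andbT.
  have [ms'|] := ltnP m.+1 (size mu); last by rewrite /d => /leg_dim_oversize->.
  rewrite leqNgt -Hx //; apply/negP => am1.
  by have := mmax m.+1; rewrite ms' am1 ltnn => /(_ isT).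
exists (size mu - m.+1); first by rewrite mem_iota size_rev /= ltnS leq_subr.
rewrite /in_block !block_start ?leq_subr //; last by rewrite -subSn // subSS leq_subr.
rewrite S -subSn // subSS subKn; last exact: ltnW.
by rewrite le_start // le_start.
Qed.

(** Passing from values to positions, the set of [p] with [w p < d m] plays the part of the pivot
    set of level [m], and [w] has to increase on positions that no pivot set separates. *)
Lemma SpermP (w : {perm 'I_r}) :
  reflect (forall p p' : 'I_r, w p < w p' ->
             (forall m, m < size mu -> (w p < d m) = (w p' < d m)) -> p < p')
          (w \in Sperm r (mutilde r mu)).
Proof.
rewrite inE; apply: (iffP forallP) => [H p p' lt eqd | H a].
  have /forallP/(_ (w p'))/implyP := H (w p); rewrite !permK; apply.
  by rewrite lt; apply/same_blockP.
apply/forallP=> b; apply/implyP=> /andP[ab /same_blockP sb].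
by apply: H; rewrite !permKV //; apply: sb.
Qed.

(** An inversion cannot stay within a block, so some [d m] separates its two values. The least such
    [m] names the map in which the pair is a free entry: the source map for level 0, otherwise the
    leg map from level [m.+1] to level [m]. *)
Lemma inversion_level (w : {perm 'I_r}) (p p' : 'I_r) :
  w \in Sperm r (mutilde r mu) -> p < p' -> w p' < w p ->
  w p' < d 0 <= w p \/
  exists2 m, m.+1 < size mu & (w p' < d m.+1 <= w p) && (w p < d m).
Proof.
move=> /SpermP Hw pp' inv.
have ex : exists m, (m < size mu) && (w p' < d m <= w p).
  case: (boolP [exists m : 'I_(size mu), w p' < d m <= w p]) => [/existsP[m Hm]|].
    by exists m; rewrite ltn_ord.
  rewrite negb_exists => /forallP nex; suff : p' < p by rewrite ltnNge (ltnW pp').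
  apply: Hw => // m ms; have := nex (Ordinal ms) => /=.
  have [_|le _] := ltnP (w p') (d m); first by rewrite /= -ltnNge => ->.
  by rewrite ltnNge (leq_trans le (ltnW inv)).
case: (ex_minnP ex) => -[|m] /andP[ms Hm] mmin; first by left.
right; exists m; rewrite // Hm /= ltnNge; apply/negP => le.
case/andP: Hm => Hm _; have := mmin m.
rewrite (ltnW ms) le (leq_trans Hm) ?ltnn ?leg_dim_anti //.
by move/(_ isT).
Qed.

Lemma card_perm_lt (w : {perm 'I_r}) n : n <= r -> #|[set p | w p < n]| = n.
Proof.
move=> nr; have -> : [set p | w p < n] = [set (w^-1)%g q | q in [set q : 'I_r | q < n]].
  apply/setP=> p; rewrite inE; apply/idP/imsetP => [lt|[q]].
    by exists (w p); rewrite ?inE // permK.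
  by rewrite inE => lt ->; rewrite permKV.
rewrite card_imset; last exact: perm_inj.
have -> : [set q : 'I_r | q < n] = [set widen_ord nr c | c in 'I_n].
  apply/setP=> q; rewrite inE; apply/idP/imsetP => [lt|[c _ ->] //=].
  by exists (Ordinal lt) => //; apply: val_inj.
by rewrite card_imset ?card_ord // => c c' [] /val_inj.
Qed.

Lemma perm_lt_inj (w w' : {perm 'I_r}) :
  (forall p p', (w p < w p') = (w' p < w' p')) -> w = w'.
Proof.
move=> H; apply/permP=> p; apply: val_inj => /=.
rewrite -[LHS](@card_perm_lt w); last exact: ltnW.
rewrite -[RHS](@card_perm_lt w'); last exact: ltnW.
by apply: eq_card => p'; rewrite !inE H.
Qed.

(** If some [d m] separates [w p] from [w p'], the pivot sets decide their order; if none does, both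
    permutations order them as [p] and [p']. A permutation is determined by these comparisons. *)
Lemma Sperm_levels_inj (w w' : {perm 'I_r}) :
  w \in Sperm r (mutilde r mu) -> w' \in Sperm r (mutilde r mu) ->
  (forall m p, m < size mu -> (w p < d m) = (w' p < d m)) -> w = w'.
Proof.
move=> Hw Hw' E; apply: perm_lt_inj => p p'.
wlog suff : w w' Hw Hw' E / w p < w p' -> w' p < w' p'.
  move=> H; apply/idP/idP; first exact: H.
  by apply: H => // m q ms; rewrite E.
move=> lt.
case: (boolP [forall m : 'I_(size mu), (w p < d m) == (w p' < d m)]) => [/forallP eqd|].
  have {}eqd m : m < size mu -> (w p < d m) = (w p' < d m).
    by move=> ms; have /eqP := eqd (Ordinal ms).
  have pp' : p < p' by move/SpermP: Hw; apply.
  rewrite ltnNge leq_eqVlt; apply/negP => /orP[/eqP/val_inj/perm_inj E'|lt'].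
    by rewrite E' ltnn in pp'.
  have : p' < p by move/SpermP: Hw'; apply=> // m ms; rewrite -!E // eqd.
  by rewrite ltnNge (ltnW pp').
rewrite negb_forall => /existsP[m].
have ms := ltn_ord m; have := E m p ms; have := E m p' ms.
case: (ltnP (w p) (d m)) => [lt1|ge1]; case: (ltnP (w p') (d m)) => [lt2|ge2] //.
  by move=> /esym/negbT; rewrite -leqNgt => ge /esym/leq_trans -> .
by have := leq_ltn_trans ge1 (ltn_trans lt lt2); rewrite ltnn.
Qed.

Lemma key_perm (key : 'I_r -> nat) : injective key ->
  exists w : {perm 'I_r}, forall p p', (w p < w p') = (key p < key p').
Proof.
move=> inj; pose R p := [set p' | key p' < key p].
have Rlt p : #|R p| < r.
  rewrite -[X in _ < X]card_ord -cardsT; apply: proper_card.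
  by rewrite properT; apply/eqP => /setP/(_ p); rewrite !inE ltnn.
have mono p p' : (#|R p| < #|R p'|) = (key p < key p').
  have [lt|ge] := ltnP (key p) (key p').
    apply: proper_card; apply/properP; split; last by exists p; rewrite !inE ?ltnn.
    by apply/subsetP=> q; rewrite !inE => /ltn_trans; apply.
  apply/negbTE; rewrite -leqNgt; apply: subset_leq_card; apply/subsetP=> q.
  by rewrite !inE => /leq_trans; apply.
have f_inj : injective (fun p => Ordinal (Rlt p)).
  move=> p p' [] E; apply: inj; apply/eqP.
  rewrite eqn_leq (leqNgt (key p)) (leqNgt (key p')) -!mono.
  by rewrite E ltnn.
by exists (perm f_inj) => p p'; rewrite !permE mono.
Qed.

Lemma levels_perm (I : nat -> pred 'I_r) :
  (forall m, m < size mu -> #|I m| = d m) ->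
  (forall m, m.+1 < size mu -> {subset I m.+1 <= I m}) ->
  exists2 w : {perm 'I_r}, w \in Sperm r (mutilde r mu) &
    forall m p, m < size mu -> (w p < d m) = (p \in I m).
Proof.
move=> cardI nest.
have nestD m t p : m + t < size mu -> p \in I (m + t) -> p \in I m.
  elim: t => [|t IHt]; first by rewrite addn0.
  by rewrite addnS => H /nest-/(_ H); apply: IHt; apply: ltnW.
(* The number of sets missing [p]; the sets being nested, a smaller value means that [p] survives
   further along the leg. *)
pose lab p := \sum_(m < size mu) (p \notin I m).
have labP p p' m : m < size mu -> lab p <= lab p' -> p' \in I m -> p \in I m.
  move=> ms le Ip'; apply: contraLR le => nIp; rewrite -ltnNge /lab.
  rewrite (bigD1 (Ordinal ms)) //= [ltnRHS](bigD1 (Ordinal ms)) //= Ip' nIp.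
  rewrite add0n add1n ltnS; apply: leq_sum => m' _.
  have [le|gt] := leqP m' m.
    rewrite (_ : p' \in I m') //; apply: (nestD _ (m - m')); rewrite ?subnKC //.
  rewrite (_ : p \notin I m') ?leq_b1 //; apply: contra nIp.
  by rewrite -{1}(subnKC (ltnW gt)); apply: nestD; rewrite subnKC // ltnW.
(* Lexicographic order on [lab p] and [p], coded as one number because [p < r]. *)
pose key p := lab p * r + p.
have keyE p p' : (key p < key p') = (lab p < lab p') || (lab p == lab p') && (p < p').
  rewrite /key; case: (ltngtP (lab p) (lab p')) => [lt|gt|->] /=; last by rewrite ltn_add2l.
    apply: (@leq_trans ((lab p).+1 * r)).
      by rewrite mulSn addnC ltn_add2r.
    by apply: leq_trans (leq_addr _ _); rewrite leq_mul2r lt orbT.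
  apply/negbTE; rewrite -leqNgt; apply: (@leq_trans ((lab p').+1 * r)).
    by rewrite mulSn addnC leq_add2r ltnW.
  by apply: leq_trans (leq_addr _ _); rewrite leq_mul2r gt orbT.
have key_inj : injective key.
  move=> p p' E; have := keyE p p'; have := keyE p' p; rewrite E ltnn.
  case: (ltngtP (lab p') (lab p)) => //= _ /esym/negbT + /esym/negbT.
  rewrite -!leqNgt => le1 le2.
  by apply/val_inj/eqP; rewrite eqn_leq le1 le2.
have [w wE] := key_perm key_inj.
have wI m p : m < size mu -> (w p < d m) = (p \in I m).
  (* [I m] is closed downwards for the order of [w], so a member [q] has [(w q).+1] elements of
     [I m] up to it and [w q < d m]. Equal cardinalities then turn the inclusion into equality. *)
  move=> ms; have sub : [set q | q \in I m] \subset [set q | w q < d m].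
    apply/subsetP=> q; rewrite !inE => Iq.
    rewrite -(cardI _ ms) -(@card_perm_lt w (w q).+1) //.
    apply: subset_leq_card; apply/subsetP=> q'; rewrite inE ltnS leq_eqVlt.
    case/orP => [/eqP/val_inj/perm_inj->//|]; rewrite wE keyE => lt.
    apply: (labP _ q m) => //.
    by case/orP: lt => [/ltnW//|/andP[/eqP-> _]].
  have : [set q | q \in I m] == [set q | w q < d m].
    rewrite eqEcard sub card_perm_lt ?leg_dim_le // -(cardI _ ms) cardsE.
    by rewrite leq_eqVlt; apply/orP; left; apply/eqP/eq_card.
  by move=> /eqP/setP/(_ p); rewrite !inE.
exists w => //; apply/SpermP => p p' lt eqd.
have labE : lab p = lab p'.
  by apply: eq_bigr => m _; rewrite -!wI ?eqd.
by move: lt; rewrite wE keyE labE ltnn eqxx.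
Qed.

(** The fixed enumeration of the pivot set of level [m], in the order given by [w]; it labels the
    basis of the normal form. *)
Definition pos (w : {perm 'I_r}) m (c : 'I_(d m)) : 'I_r :=
  (w^-1)%g (widen_ord (leg_dim_le m) c).

Lemma pos_inj w m : injective (@pos w m).
Proof. by move=> c c' /perm_inj [] /val_inj. Qed.

Lemma codom_pos w m p : (p \in codom (@pos w m)) = (w p < d m).
Proof.
apply/codomP/idP => [[c ->]|lt]; first by rewrite permKV /= ltn_ord.
by exists (Ordinal lt); apply: (canRL (permK w)); apply: val_inj.
Qed.

End Blocks.

(** * Torus classes of edge weights *)

Section Connectivity.
Variables (r k : nat).

Lemma connected_constant (T : Type) (E : {set 'I_r * 'I_r * 'I_k}) (f : 'I_r -> T) :
  connected_spanning E -> (forall e, e \in E -> f e.1.1 = f e.1.2) ->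
  forall l l', f l = f l'.
Proof.
move=> conn fE l l'; have /forallP/(_ l)/forallP/(_ l')/connectP[p] := conn.
elim: p l => [|a p IH] l /=; first by move=> _ ->.
case/andP=> /existsP[t adj] path last; rewrite -(IH a path last).
by case/orP: adj => /fE.
Qed.

Lemma disconnected_set (E : {set 'I_r * 'I_r * 'I_k}) :
  ~~ connected_spanning E -> exists S : {set 'I_r},
  [/\ forall e, e \in E -> (e.1.1 \in S) = (e.1.2 \in S),
      exists l, l \in S & exists l, l \notin S].
Proof.
rewrite negb_forall => /existsP[l]; rewrite negb_forall => /existsP[l' nc].
exists [set y | connect (edge_adj E) l y]; split.
- move=> [[p p'] t] /= eE; rewrite !inE; apply/idP/idP => /connect_trans; apply.
    by apply: connect1; apply/existsP; exists t; rewrite eE.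
  by apply: connect1; apply/existsP; exists t; rewrite eE orbT.
- by exists l; rewrite inE connect0.
- by exists l'; rewrite inE.
Qed.

End Connectivity.

(** * Counting weights up to the torus *)

Section TorusClasses.
Variables (r k : nat) (F : finFieldType).
Hypothesis r0 : 0 < r.
Local Notation perms := {ffun 'I_k -> {perm 'I_r}}.
Local Notation weights := {ffun 'I_r * 'I_r * 'I_k -> F}.
Variable P : pred perms.

Definition wsupp (x : weights) : {set 'I_r * 'I_r * 'I_k} :=
  [set e | x e != 0%R].

Definition torus_related (t : {ffun 'I_r -> F}) (x x' : weights) : bool :=
  [forall l, t l != 0%R] &&
  [forall e, x e * t e.1.1 == t e.1.2 * x' e]%R.

Definition normal_data : {set perms * weights} :=
  [set z | [&& P z.1, wsupp z.2 \subset inv_edges z.1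
             & connected_spanning (wsupp z.2)]].

Definition torus_eq (z z' : perms * weights) : bool :=
  (z.1 == z'.1) && [exists t, torus_related t z.2 z'.2].

Lemma torus_relatedP (t : {ffun 'I_r -> F}) (x x' : weights) :
  reflect ((forall l, t l != 0%R) /\ (forall e, x e * t e.1.1 = t e.1.2 * x' e)%R)
          (torus_related t x x').
Proof.
by apply: (iffP andP) => -[/forallP H1 H2]; split=> //;
  [move=> e; apply/eqP; apply: (forallP H2) | apply/forallP => e; rewrite H2].
Qed.

Lemma torus_eq_refl z : torus_eq z z.
Proof.
rewrite /torus_eq eqxx; apply/existsP; exists [ffun => 1%R]; apply/torus_relatedP.
by split=> *; rewrite !ffunE ?oner_eq0 ?mulr1 ?mul1r.
Qed.

Lemma torus_eq_sym z z' : torus_eq z z' -> torus_eq z' z.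
Proof.
case/andP=> /eqP E /existsP[t /torus_relatedP[t0 tE]].
rewrite /torus_eq E eqxx; apply/existsP; exists [ffun l => (t l)^-1%R].
apply/torus_relatedP; split=> [l|e]; rewrite !ffunE ?invr_eq0 //.
apply: (mulfI (t0 e.1.2)); rewrite mulrA -tE mulfK // mulrA mulfV //.
by rewrite mul1r.
Qed.

Lemma torus_eq_trans z1 z2 z3 : torus_eq z1 z2 -> torus_eq z2 z3 -> torus_eq z1 z3.
Proof.
case/andP=> /eqP E1 /existsP[t /torus_relatedP[t0 tE]].
case/andP=> /eqP E2 /existsP[u /torus_relatedP[u0 uE]].
rewrite /torus_eq E1 E2 eqxx; apply/existsP; exists [ffun l => t l * u l]%R.
apply/torus_relatedP; split=> [l|e]; rewrite !ffunE ?mulf_neq0 //.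
by rewrite mulrA tE -!mulrA uE mulrA.
Qed.

Lemma torus_eq_equivalence : {in normal_data & &, equivalence_rel torus_eq}.
Proof.
move=> x y z _ _ _; split=> [|xy]; first exact: torus_eq_refl.
apply/idP/idP; first exact: torus_eq_trans (torus_eq_sym xy).
exact: torus_eq_trans xy.
Qed.

Lemma wsupp_related t x x' : torus_related t x x' -> wsupp x = wsupp x'.
Proof.
case/torus_relatedP=> t0 tE; apply/setP=> e; rewrite !inE.
apply/idP/idP; apply: contraNneq => xe; have := tE e; rewrite xe ?mulr0 ?mul0r.
  by move/eqP; rewrite mulf_eq0 (negPf (t0 _)) orbF.
by move/esym/eqP; rewrite mulf_eq0 (negPf (t0 _)).
Qed.

Lemma card_ffun_family (A : finType) (f : A -> pred F) :
  #|[set x : {ffun A -> F} | [forall a, f a (x a)]]| = \prod_a #|f a|.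
Proof.
rewrite cardsE -(big_enum _ _ _ (fun a => #|f a|)) /=.
have := card_family (rT := fun _ : A => F) (fun a => f a).
rewrite foldrE big_map => <-.
by apply: eq_card => x; rewrite !inE; apply: eq_forallb.
Qed.

Lemma card_nonzero : #|[pred a : F | a != 0%R]| = #|F|.-1.
Proof. by rewrite -(cardC1 (0%R : F)); apply: eq_card. Qed.

(** Constant [t] act trivially, so the orbit is reached by the [t] with value 1 at [l0]. If two of
    these act alike, their quotient is constant along the edges of a connected graph, hence equal to
    1. *)
Lemma card_torus_orbit x : connected_spanning (wsupp x) ->
  #|[set x' | [exists t, torus_related t x x']]| = #|F|.-1 ^ r.-1.
Proof.
move=> conn; pose l0 := Ordinal r0.
pose f1 (l : 'I_r) : pred F := if l == l0 then pred1 1%R else [pred a | a != 0%R].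
pose T1 := [set t : {ffun 'I_r -> F} | [forall l, f1 l (t l)]].
have cT1 : #|T1| = #|F|.-1 ^ r.-1.
  rewrite (card_ffun_family f1) (bigD1 l0) //= {1}/f1 eqxx card1 mul1n.
  rewrite (eq_bigr (fun => #|F|.-1)); last first.
    by move=> l /negPf E; rewrite /f1 E card_nonzero.
  by rewrite prod_nat_const cardC1 card_ord.
pose act (t : {ffun 'I_r -> F}) : weights := [ffun e => x e * t e.1.1 / t e.1.2]%R.
have T1P t : t \in T1 -> t l0 = 1%R /\ forall l, t l != 0%R.
  rewrite inE => /forallP H; have := H l0; rewrite /f1 eqxx => /eqP t1; split=> // l.
  by have := H l; rewrite /f1; case: eqP => [->|] //; rewrite t1 oner_eq0.
rewrite -cT1 -(card_in_imset (f := act) (D := mem T1)).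
  apply: eq_card => x'; rewrite !inE; apply/existsP/imsetP.
    case=> t /torus_relatedP[t0 tE].
    exists [ffun l => t l / t l0]%R.
      rewrite inE; apply/forallP=> l; rewrite ffunE /f1; case: eqP => [->|_] /=.
        by rewrite mulfV.
      by rewrite mulf_neq0 ?invr_eq0.
    apply/ffunP=> e; rewrite !ffunE invf_div.
    by rewrite !mulrA divfK // tE mulrC mulKf.
  case=> t /T1P[t1 t0] ->; exists t.
  by apply/torus_relatedP; split=> // e; rewrite ffunE [RHS]mulrC divfK.
move=> t t' /T1P[t1 t0] /T1P[t1' t0'] /ffunP E.
have c l : (t l / t' l = 1)%R.
  transitivity (t l0 / t' l0)%R; last by rewrite t1 t1' divr1.
  apply: (connected_constant (f := fun l => t l / t' l)%R conn) => e.
  rewrite inE => xe.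
  have := E e; rewrite !ffunE -!mulrA => /(mulfI xe) Et.
  apply/eqP; rewrite eqr_div //; apply/eqP.
  have := Et; move/eqP; rewrite eqr_div // => /eqP ->; exact: mulrC.
by apply/ffunP=> l; apply: (mulIf (invr_neq0 (t0' l))); rewrite c mulfV.
Qed.

Lemma card_torus_class z : z \in normal_data ->
  #|[set z' in normal_data | torus_eq z z']| = #|F|.-1 ^ r.-1.
Proof.
case: z => w x; rewrite inE /= => /and3P[Pw sub conn].
rewrite -(card_torus_orbit conn).
rewrite -[RHS](card_imset (f := fun x' : weights => (w, x'))); last by move=> ? ? [].
apply: eq_card => -[w' x']; rewrite !inE; apply/andP/imsetP.
  by case=> _ /andP[/= /eqP <- rel]; exists x'; rewrite ?inE.
case=> x2; rewrite inE => rel [-> ->] /=.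
split; last by rewrite /torus_eq eqxx.
by case/existsP: rel => t /wsupp_related <-; rewrite Pw sub.
Qed.

Lemma card_wsupp E : #|[set x : weights | wsupp x == E]| = #|F|.-1 ^ #|E|.
Proof.
pose f e : pred F := if e \in E then [pred a | a != 0%R] else pred1 0%R.
transitivity #|[set x : weights | [forall e, f e (x e)]]|.
  apply: eq_card => x; rewrite !inE; apply/eqP/forallP => [xE e|H].
    by rewrite /f -xE inE; case: ifP => // /negbT; rewrite negbK.
  by apply/setP=> e; have := H e; rewrite inE /f; case: ifP => //= _ /eqP->; rewrite eqxx.
rewrite (card_ffun_family f) (bigID (mem E)) /= [X in _ * X]big1 ?muln1.
  rewrite (eq_bigr (fun => #|F|.-1)) ?prod_nat_const // => e eE.
  by rewrite /f eE card_nonzero.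
by move=> e /negPf eE; rewrite /f eE card1.
Qed.

(* If q > 2 the exponent is not truncated because a torus class, of size
   (q-1)^(r-1), lies in the set of the (q-1)^#|E| weights supported on E. *)
Lemma connected_exponent (E : {set 'I_r * 'I_r * 'I_k}) : connected_spanning E ->
  (#|F| - 1) ^ (#|E|.+1 - r) * #|F|.-1 ^ r.-1 = #|F|.-1 ^ #|E|.
Proof.
move=> conn; rewrite subn1; have [q2|q2] := leqP #|F|.-1 1.
  (* For two elements in [F] all powers are 1, so truncation of the exponent is harmless. *)
  suff -> : #|F|.-1 = 1 by rewrite !exp1n.
  by apply/eqP; rewrite eqn_leq q2 -ltnS prednK ?card_finNzRing_gt1 // ltnW ?card_finNzRing_gt1.
rewrite -expnD; congr (_ ^ _).
suff le : r.-1 <= #|E| by rewrite -[X in _ - X](prednK r0) subSS subnK.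
rewrite -(leq_exp2l _ _ q2) -card_wsupp.
pose x : weights := [ffun e => if e \in E then 1%R else 0%R].
have xE : wsupp x = E.
  by apply/setP=> e; rewrite inE ffunE; case: ifP; rewrite ?oner_eq0 ?eqxx.
rewrite -(@card_torus_orbit x) ?xE //; apply: subset_leq_card; apply/subsetP=> x'.
by rewrite !inE => /existsP[t /wsupp_related <-]; rewrite xE.
Qed.

(** Sort the pairs by permutation and then by support [E]. The [(q-1)^#|E|] weights on [E]
    contribute the term of [E] in [Rw] times the size of a torus class. *)
Lemma card_normal_data :
  #|normal_data| = (\sum_(w | P w) Rw w #|F|) * #|F|.-1 ^ r.-1.
Proof.
rewrite big_distrl /= -sum1_card.
rewrite (eq_bigl (fun z : perms * weights => P z.1 &&
  ((wsupp z.2 \subset inv_edges z.1) && connected_spanning (wsupp z.2)))); last first.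
  by move=> z; rewrite inE.
rewrite -(pair_big_dep P (fun w x => (wsupp x \subset inv_edges w) &&
  connected_spanning (wsupp x)) (fun _ _ => 1)) /=.
apply: eq_bigr => w _; rewrite /Rw big_distrl /=.
rewrite (partition_big wsupp (fun E => (E \subset inv_edges w) && connected_spanning E)) //=.
apply: eq_bigr => E /andP[sub conn]; rewrite connected_exponent // -card_wsupp -sum1_card.
by apply: eq_bigl => x; rewrite inE andb_idl // => /eqP->; rewrite sub.
Qed.

(** All torus classes have the same positive size, so dividing the number of pairs by it shows that
    there are as many classes as the sum of the [Rw]; a transversal then supplies the
    representatives. *)
Lemma normal_data_transversal :
  exists z : 'I_(\sum_(w | P w) Rw w #|F|) -> perms * weights,
    [/\ forall i, z i \in normal_data,
        forall i j, torus_eq (z i) (z j) -> i = j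
      & forall y, y \in normal_data -> exists i, torus_eq y (z i)].
Proof.
set N := \sum_(w | P w) _.
pose C := equivalence_partition torus_eq normal_data.
have partC : partition C normal_data := equivalence_partitionP torus_eq_equivalence.
have cardC : #|C| = N.
  have q0 : 0 < #|F|.-1 ^ r.-1.
    by rewrite expn_gt0 -ltnS prednK ?card_finNzRing_gt1 // ltnW ?card_finNzRing_gt1.
  apply/eqP; rewrite -(eqn_pmul2r q0) -card_normal_data eq_sym; apply/eqP.
  apply: (card_uniform_partition _ partC) => _ /imsetP[y yD ->].
  exact: card_torus_class.
have tr := transversalP partC; set X := transversal C normal_data in tr.
have cardX : N = #|X| by rewrite (card_transversal tr).
have XD : {subset X <= normal_data} by apply/subsetP; apply: transversal_sub tr.
exists (fun i => enum_val (cast_ord cardX i)); split=> [i|i j E|y yD].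
- by apply: XD; apply: enum_valP.
- apply: (@cast_ord_inj _ _ cardX); apply: enum_val_inj.
  apply: (pblock_inj tr); try exact: enum_valP.
  apply: same_pblock; first by case/and3P: partC.
  by rewrite (pblock_equivalence_partition torus_eq_equivalence) ?XD ?enum_valP // torus_eq_sym.
- have yC : pblock C y \in C by rewrite pblock_mem // (cover_partition partC).
  pose u := transversal_repr y X (pblock C y).
  have uX : u \in X := repr_mem_transversal tr y yC.
  have uy : u \in pblock C y := repr_mem_pblock tr y yC.
  rewrite (pblock_equivalence_partition torus_eq_equivalence) ?(XD _ uX) // in uy.
  by exists (cast_ord (esym cardX) (enum_rank_in uX u)); rewrite cast_ordKV enum_rankK_in.
Qed.

End TorusClasses.

(** * Normal forms of a leg *)

Section LegRigidity.
Local Open Scope ring_scope.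
Variables (L : fieldType) (r : nat).
Implicit Types (x : 'I_r -> 'I_r -> L) (t : 'I_r -> L).

Lemma relabel_tr a b (t : 'I_r -> L) (phi : 'I_a -> 'I_r) (psi : 'I_b -> 'I_r) :
  (relabel t phi psi)^T = relabel t psi phi.
Proof. by apply/matrixP=> c c'; rewrite !mxE; case: eqVneq => [->|]. Qed.

(** The map out of the sources is surjective, so it is its transpose that has an echelon form.
    Transposing moves the torus to the other side and exchanges [x] and [x'] in the edge
    relation. *)
Lemma nf_tr_twist n x x' t (phi phi' : 'I_n -> 'I_r) :
  injective phi -> injective phi' -> codom phi =i codom phi' ->
  (forall p p', p \notin codom phi -> p' \in codom phi ->
     x' p p' * t p = t p' * x p p' :> L) ->
  (nf x phi id)^T *m relabel t phi phi' = relabel t id id *m (nf x' phi' id)^T.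
Proof.
move=> i1 i2 E H; apply: trmx_inj; rewrite !trmx_mul !trmxK !relabel_tr.
apply/esym/nf_twist => //.
by move=> p p'; rewrite -!E => Hp _; apply: H.
Qed.

Lemma nf_tr_stab n x x' t (phi phi' : 'I_n -> 'I_r) (g : 'M[L]_n) :
  injective phi -> codom phi =i codom phi' ->
  (nf x phi id)^T *m g = relabel t id id *m (nf x' phi' id)^T ->
  g = relabel t phi phi' /\
  (forall p p', p \notin codom phi -> p' \in codom phi ->
     x' p p' * t p = t p' * x p p').
Proof.
move=> i1 E /(congr1 trmx); rewrite !trmx_mul !trmxK relabel_tr => /esym H.
have in_id p : p \in codom (@id 'I_r) by apply: (codom_f id p).
have E' : codom phi' =i codom phi by move=> p; rewrite E.
have [gE rel] := nf_stab i1 (@inj_id _) E' (fun _ => erefl) (fun p _ => in_id p) H.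
split; first by apply: trmx_inj; rewrite gE relabel_tr.
by move=> p p' Hp Hp'; apply: rel; rewrite -?E.
Qed.

Lemma nf_tr_codom n x x' t (phi phi' : 'I_n -> 'I_r) (g : 'M[L]_n) :
  injective phi -> (forall p, t p != 0) ->
  (forall p p', x p p' != 0 -> (p < p')%N) ->
  (forall p p', x' p p' != 0 -> (p < p')%N) ->
  g \in unitmx ->
  (nf x phi id)^T *m g = relabel t id id *m (nf x' phi' id)^T ->
  {subset codom phi' <= codom phi}.
Proof.
move=> i1 t0 tri tri' gu /(congr1 trmx).
rewrite !trmx_mul !trmxK relabel_tr => /esym H.
have in_id p : p \in codom (@id 'I_r) by apply: (codom_f id p).
by apply: (nf_codom _ _ _ _ _ t0 tri' tri _ H); rewrite ?unitmx_tr.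
Qed.

Lemma codom_eq_sub n (phi phi' : 'I_n -> 'I_r) :
  injective phi -> injective phi' -> {subset codom phi <= codom phi'} ->
  codom phi =i codom phi'.
Proof.
move=> i1 i2 sub; apply/subset_cardP; last exact/subsetP.
by rewrite !card_codom.
Qed.

End LegRigidity.

Section Leg.
Local Open Scope ring_scope.
Variables (L : fieldType) (r : nat) (mu : seq nat).
Implicit Types (x : 'I_r -> 'I_r -> L) (t : 'I_r -> L).
Hypotheses (r0 : (0 < r)%N) (mu_nil : (0 < size mu)%N) (mu_r : (sumn mu <= r)%N).
Let s := (size mu).-1.
Let d := leg_dim mu.
Local Notation P w m := (@pos r mu mu_r w m).

(* The maps out of the sources (l) run against the leg maps; inverting their
   weights lets the torus act by the same formula on all edges. *)
Definition inverse_weights (x : 'I_r -> 'I_r -> L) p p' := (x p p')^-1.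

(** The sources are one-dimensional, so a morphism acts on them by the scalars [t], shared by all
    legs. Invertibility is not built in: isomorphisms and idempotents are both treated. *)
Definition leg_morphism (R R' : 'M[L]_(r, d 0)) (M M' : forall m, 'M[L]_(d m.+1, d m))
    t (g : forall m, 'M[L]_(d m)) : Prop :=
  R *m g 0%N = relabel t id id *m R' /\
  forall m, (m < s)%N -> M m *m g m = g m.+1 *m M' m.

Definition nf_source x w : 'M[L]_(r, d 0) := (nf (inverse_weights x) (P w 0) id)^T.
Definition nf_leg x w m : 'M[L]_(d m.+1, d m) := nf x (P w m.+1) (P w m).

Lemma pos_nest w m : {subset codom (P w m.+1) <= codom (P w m)}.
Proof.
by move=> p; rewrite !codom_pos => /leq_trans; apply; apply: leg_dim_anti.
Qed.

Lemma inverse_weights_neq0 x p p' : (inverse_weights x p p' != 0) = (x p p' != 0).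
Proof. by rewrite invr_eq0. Qed.

(** Going outwards from level 0, each level's component is forced by the preceding one, hence
    ultimately by [t]. What remains is one relation per free entry. *)
Lemma leg_rigid x x' (w w' : {perm 'I_r}) t g :
  (forall m, (m <= s)%N -> codom (P w m) =i codom (P w' m)) ->
  leg_morphism (nf_source x w) (nf_source x' w') (nf_leg x w) (nf_leg x' w') t g ->
  [/\ forall m, (m <= s)%N -> g m = relabel t (P w m) (P w' m),
      forall p p', (w p' < d 0 <= w p)%N ->
        inverse_weights x' p p' * t p = t p' * inverse_weights x p p'
    & forall m p p', (m < s)%N -> (w p' < d m.+1 <= w p)%N -> (w p < d m)%N ->
        x p p' * t p = t p' * x' p p'].
Proof.
move=> E [E0 ES].
have [g0 rel0] := nf_tr_stab (@pos_inj _ _ mu_r w 0) (E 0%N isT) E0.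
have gE m : (m <= s)%N -> g m = relabel t (P w m) (P w' m).
  elim: m => // m IH ms; have := ES m ms; rewrite IH; last exact: ltnW.
  by case/(nf_stab (@pos_inj _ _ _ _ _) (@pos_inj _ _ _ _ _) (E _ ms)
    (E _ (ltnW ms)) (@pos_nest w m)).
split=> // [p p'|m p p' ms].
  case/andP=> H1 H2; apply: rel0; rewrite codom_pos //.
  by rewrite -leqNgt.
case/andP=> H1 H2 H3; have := ES m ms; rewrite gE; last exact: ltnW.
case/(nf_stab (@pos_inj _ _ _ _ _) (@pos_inj _ _ _ _ _) (E _ ms)
  (E _ (ltnW ms)) (@pos_nest w m)) => _; apply; rewrite codom_pos //.
by rewrite -leqNgt.
Qed.

(** The induction carries the shape of [g m] along with the pivot sets: the comparison of pivots at
    level [m.+1] applies only once the basis change at level [m] is known to be a [relabel]. *)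
Lemma leg_levels x x' (w w' : {perm 'I_r}) t g :
  (forall p, t p != 0) -> (forall m, (m <= s)%N -> g m \in unitmx) ->
  (forall p p', x p p' != 0 -> (p < p')%N) ->
  (forall p p', x' p p' != 0 -> (p < p')%N) ->
  leg_morphism (nf_source x w) (nf_source x' w') (nf_leg x w) (nf_leg x' w') t g ->
  forall m, (m <= s)%N -> codom (P w m) =i codom (P w' m).
Proof.
move=> t0 gu tri tri' [E0 ES] m ms.
suff [] : codom (P w m) =i codom (P w' m) /\ g m = relabel t (P w m) (P w' m) by [].
elim: m ms => [|m IH] ms.
  have tri1 p p' : inverse_weights x p p' != 0 -> (p < p')%N.
    by rewrite inverse_weights_neq0 => /tri.
  have tri1' p p' : inverse_weights x' p p' != 0 -> (p < p')%N.
    by rewrite inverse_weights_neq0 => /tri'.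
  have sub := nf_tr_codom (@pos_inj _ _ mu_r w 0) t0 tri1 tri1' (gu _ ms) E0.
  have E : codom (P w 0) =i codom (P w' 0).
    by move=> p; rewrite -(codom_eq_sub _ _ sub) //; apply: pos_inj.
  by split=> //; have [] := nf_tr_stab (@pos_inj _ _ mu_r w 0) E E0.
have [E gE] := IH (ltnW ms); have := ES m ms; rewrite gE => H.
have sub : {subset codom (P w m.+1) <= codom (P w' m.+1)}.
  apply: (nf_codom _ _ E _ _ t0 tri tri' (gu _ ms) H); try exact: pos_inj.
    exact: pos_nest.
  exact: pos_nest.
have E' := codom_eq_sub (@pos_inj _ _ _ _ _) (@pos_inj _ _ _ _ _) sub.
by split=> //; case/(nf_stab (@pos_inj _ _ _ _ _) (@pos_inj _ _ _ _ _) E' E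
  (@pos_nest w m)): H.
Qed.

(** Both relations are assumed because [t] may vanish, and then the one for inverted weights does
    not follow from the other. *)
Lemma leg_twist x x' (w : {perm 'I_r}) t :
  (forall p p', inverse_weights x' p p' * t p = t p' * inverse_weights x p p') ->
  (forall p p', x p p' * t p = t p' * x' p p') ->
  leg_morphism (nf_source x w) (nf_source x' w) (nf_leg x w) (nf_leg x' w) t
    (fun m => relabel t (P w m) (P w m)).
Proof.
move=> H1 H2; split=> [|m ms].
  by apply: nf_tr_twist => //; apply: pos_inj.
by apply: nf_twist => //; apply: pos_inj.
Qed.

Lemma relabel_id n (phi : 'I_n -> 'I_r) c : injective phi ->
  relabel (fun _ => c) phi phi = c%:M :> 'M[L]_n.
Proof.
move=> inj; apply/matrixP=> a b; rewrite !mxE (inj_eq inj).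
by case: eqP.
Qed.

Lemma leg_normalizable (R : 'M[L]_(r, d 0)) (M : forall m, 'M[L]_(d m.+1, d m)) :
  row_free R^T -> (forall m, (m < s)%N -> row_free (M m)) ->
  exists (w : {perm 'I_r}) (x : 'I_r -> 'I_r -> L) (g : forall m, 'M[L]_(d m)),
    [/\ w \in Sperm r (mutilde r mu),
        forall p p', x p p' != 0 -> (p < p')%N && (w p' < w p)%N,
        forall m, (m <= s)%N -> g m \in unitmx
      & leg_morphism R (nf_source x w) M (nf_leg x w) (fun _ => 1) g].
Proof.
move=> freeR freeM.
have [f [h [N [hu RN Nf Nmax]]]] := echelon_exists (fun q : 'I_r => q : nat) freeR.
have injf : injective f.
  move=> c c' ff; apply/eqP; have := Nf c c; rewrite ff Nf eqxx.
  by case: eqP => // _ /eqP; rewrite eq_sym oner_eq0.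
have g0u : invmx h^T \in unitmx by rewrite unitmx_inv unitmx_tr.
have [phi [g [x [phiE gE leg tri]]]] := leg_normal_form r0 injf g0u freeM.
have inj m : (m <= s)%N -> injective (phi m).
  by case: m => [|m] ms; [rewrite phiE | have [] := leg m ms].
have gu m : (m <= s)%N -> g m \in unitmx.
  by case: m => [|m] ms; [rewrite gE | have [] := leg m ms].
have nest m : (m < s)%N -> {subset codom (phi m.+1) <= codom (phi m)}.
  by move=> ms; have [] := leg m ms.
have ltS m : (m < size mu)%N = (m <= s)%N by rewrite -(prednK mu_nil).
have [w Sw wE] : exists2 w : {perm 'I_r}, w \in Sperm r (mutilde r mu) &
    forall m p, (m < size mu)%N -> (w p < d m)%N = (p \in codom (phi m)).
  apply: (levels_perm mu_nil mu_r (I := fun m => mem (codom (phi m)))) => m ms.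
    by rewrite card_codom ?card_ord //; apply: inj; rewrite -ltS.
  by move=> p; apply: nest; rewrite -ltS.
have codE m : (m <= s)%N -> codom (phi m) =i codom (P w m).
  by move=> ms p; rewrite codom_pos wE // ltS.
have cod0 : codom f =i codom (P w 0) by rewrite -phiE; apply: codE.
(* Labels outside [codom f] are not pivots of the source map, so their entries come from it,
   inverted to cancel [inverse_weights]; the sum has at most one term. *)
pose y p p' := if p \in codom f then x p p' else
  (\sum_(c | f c == p') N c p)^-1.
have yE c p : p \notin codom f -> inverse_weights y p (f c) = N c p.
  move=> np; rewrite /inverse_weights /y (negPf np) invrK.
  rewrite (big_pred1 c) // => c'; exact: inj_eq.
have nestf m p : (m <= s)%N -> p \in codom (phi m) -> p \in codom f.
  elim: m => [|m IH] ms; first by rewrite phiE.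
  by move/nest; move/(_ ms); apply: IH; apply: ltnW.
(* The factor [relabel] with constant 1 only reorders the bases, from the order in which pivots were
   found to that of [pos]. *)
exists w, y, (fun m => g m *m relabel (fun _ => 1) (phi m) (P w m)); split=> //.
- move=> p p'; rewrite /y; case: ifPn => [pf /tri[-> [m ms [H1 _ H3]]]|pf].
    rewrite /=; have ms' : (m.+1 < size mu)%N by rewrite ltS.
    by apply: (@leq_trans (d m.+1)); rewrite ?wE // leqNgt wE.
  rewrite invr_eq0 => S0.
  have [c /eqP fc Nc] : exists2 c, f c == p' & N c p != 0.
    apply/exists_inP; apply: contraT; rewrite negb_exists_in => /forall_inP H.
    by rewrite big1 ?eqxx // in S0 => c /H; rewrite negbK => /eqP.
  have p'f : p' \in codom f by rewrite -fc codom_f.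
  apply/andP; split.
    rewrite ltn_neqAle -{2}fc Nmax // andbT.
    by apply: contraNneq pf => /val_inj ->.
  move: pf p'f; rewrite !cod0 !codom_pos -leqNgt => le lt; exact: leq_trans lt le.
- move=> m ms; rewrite unitmx_mul gu // relabel_unit ?oner_eq0 //.
  + exact: inj.
  + exact: pos_inj.
  + exact: codE.
- split=> [|m ms].
    rewrite mulmxA gE phiE.
    have -> : R *m invmx h^T = (nf (inverse_weights y) f id)^T.
      have -> : R = N^T *m h^T by apply: trmx_inj; rewrite trmx_mul !trmxK.
      rewrite mulmxK ?unitmx_tr //; congr (_^T).
      apply/matrixP=> c q; rewrite mxE; case: ifPn => [/codomP[c' ->]|nq].
        by rewrite Nf (inj_eq injf).
      by rewrite yE.
    apply: nf_tr_twist => //; first exact: pos_inj.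
    by move=> p p' _ _; rewrite mulr1 mul1r.
  have [_ _ _ E] := leg m ms; rewrite mulmxA E -!mulmxA; congr (_ *m _).
  rewrite -(@nf_twist _ _ _ _ y y (fun _ => 1) (phi m.+1) _ (phi m)).
  + congr (_ *m _); apply/matrixP=> c c'; rewrite !mxE; case: ifP => // _.
    by rewrite /y (@nestf m) ?codom_f // ltnW.
  + exact: pos_inj.
  + by apply: inj; apply: ltnW.
  + exact: codE.
  + by apply: codE; apply: ltnW.
  + by move=> p p' _ _ _; rewrite mulr1 mul1r.
Qed.

End Leg.

(** * Representations of the supernova quiver *)

Section OrdinalFamilies.
Variables (n : nat) (T : nat -> Type) (f : forall j : 'I_n, T j) (f0 : forall m, T m).

(** Joins the quiver, whose legs are indexed by ordinals, to the chain lemmas over [nat]; the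
    dependent match supplies the bound needed to build the ordinal. *)
Definition extend_family m : T m :=
  match (m < n)%N as b return ((m < n)%N = b -> T m) with
  | true => fun h => f (Ordinal h)
  | false => fun _ => f0 m
  end erefl.

Lemma extend_familyE (j : 'I_n) : extend_family j = f j.
Proof.
case: j => m h; rewrite /extend_family.
suff E b (e : (m < n)%N = b) : match b as b return ((m < n)%N = b -> T m) with
    | true => fun h => f (Ordinal h) | false => fun _ => f0 m end e = f (Ordinal h).
  exact: E.
case: b e => e; first by rewrite (bool_irrelevance e h).
by have := h; rewrite e.
Qed.

End OrdinalFamilies.

Section Supernova.
Local Open Scope ring_scope.
Variables (r k : nat) (s : 'I_k -> nat) (mu : 'I_k -> seq nat).
Hypotheses (r0 : (0 < r)%N) (mu_size : forall i, size (mu i) = (s i).+1)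
  (mu_r : forall i, (sumn (mu i) <= r)%N).
Local Notation dim := (@sn_dim r k s mu).
Local Notation d i := (leg_dim (mu i)).
Local Notation leg_vertex i j := (inr (existT (fun i => 'I_(s i).+1) i j)).
Local Notation leg_arrow i j := (inr (existT (fun i => 'I_(s i)) i j)).

Let mu_nil i : (0 < size (mu i))%N. Proof. by rewrite mu_size. Qed.
Let sE i : (size (mu i)).-1 = s i. Proof. by rewrite mu_size. Qed.
Let r1 : 'I_r := Ordinal r0.

Section Morphisms.
Variable L : fieldType.
Implicit Types A B : qrep dim L.

Definition source_mx A i : 'M[L]_(r, d i 0) :=
  \matrix_(l, c) (A (inl (l, i)) : 'M_(1, d i 0)) 0 c.

Definition leg_mx A i m : 'M[L]_(d i m.+1, d i m) :=
  extend_family (T := fun m => 'M[L]_(d i m.+1, d i m))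
    (fun j : 'I_(s i) => A (leg_arrow i j)) (fun _ => 0) m.

Lemma leg_mxE A i (j : 'I_(s i)) : leg_mx A i j = A (leg_arrow i j).
Proof. exact: (extend_familyE (T := fun m => 'M[L]_(d i m.+1, d i m))). Qed.

Definition family (t : 'I_r -> L) (g : forall i m, 'M[L]_(d i m)) :
    forall v : qvert (supernova r s), 'M[L]_(dim v) :=
  fun v => match v with
  | inl l => (t l)%:M
  | inr (existT i j) => g i j
  end.

Definition source_part (E : forall v : qvert (supernova r s), 'M[L]_(dim v)) l : L :=
  (E (inl l) : 'M_1) 0 0.

Definition leg_part (E : forall v : qvert (supernova r s), 'M[L]_(dim v)) i m :
    'M[L]_(d i m) :=
  extend_family (T := fun m => 'M[L]_(d i m))
    (fun j : 'I_(s i).+1 => E (leg_vertex i j)) (fun _ => 0) m.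

Lemma leg_partE E i (j : 'I_(s i).+1) : leg_part E i j = E (leg_vertex i j).
Proof. exact: (extend_familyE (T := fun m => 'M[L]_(d i m))). Qed.

Lemma morphism_parts A B E :
  (forall a, A a *m E (qtgt a) = E (qsrc a) *m B a) ->
  forall i, leg_morphism (source_mx A i) (source_mx B i) (leg_mx A i) (leg_mx B i)
              (source_part E) (leg_part E i).
Proof.
move=> H i; split=> [|m].
  apply/matrixP=> l c; rewrite (@mul_relabel_l _ _ _ _ _ _ _ _ _ _ l) //.
  have := H (inl (l, i)) => /= /matrixP/(_ 0 c).
  rewrite -(@leg_partE E i ord0) !mxE big_ord1 => <-.
  by apply: eq_bigr => c' _; rewrite mxE.
rewrite sE => ms; have := H (leg_arrow i (Ordinal ms)).
by rewrite -!leg_mxE -!leg_partE.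
Qed.

Lemma family_morphism A B t g :
  (forall i, leg_morphism (source_mx A i) (source_mx B i) (leg_mx A i) (leg_mx B i)
               t (g i)) ->
  forall a, A a *m family t g (qtgt a) = family t g (qsrc a) *m B a.
Proof.
move=> H [[l i]|[i j]]; have [H0 HS] := H i.
  apply/matrixP=> c0 c; rewrite ord1 /= mul_scalar_mx mxE.
  move/matrixP/(_ l c): H0; rewrite (@mul_relabel_l _ _ _ _ _ _ _ _ _ _ l) //.
  rewrite !mxE => <-; by apply: eq_bigr => c' _; rewrite mxE.
have := HS j; rewrite sE ltn_ord => /(_ isT).
by rewrite !leg_mxE.
Qed.

(** Extend [e] by 0 to the sources and the other legs. It differs from the identity since it
    vanishes at the source [r1]. *)
Lemma leg_split_rep A i e :
  chain_split (leg_mx A i) e -> source_mx A i *m e 0%N = 0 ->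
  (exists m, e m != 0) -> exists E, qrep_split A E.
Proof.
case=> idem endo src [m em].
have ms : (m < (s i).+1)%N.
  rewrite ltnNge; apply: contra em => ms; apply/eqP/matrixP=> c.
  by have := ltn_ord c; rewrite {2}leg_dim_oversize // mu_size.
pose g := dfwith (fun i m => 0 : 'M[L]_(d i m)) e.
have gi : g i = e := dfwith_in _ _.
have gj j : i != j -> g j = (fun m => 0 : 'M[L]_(d j m)).
  by move=> ij; apply: dfwith_out.
exists (family (fun _ => 0) g); split.
- move=> [l|[j n]] /=; first by rewrite mul_scalar_mx scale0r raddf0.
  have [ij|/gj->] := eqVneq i j; last by rewrite mulmx0.
  by case: _ / ij n => n; rewrite gi idem.
- apply: family_morphism => j; rewrite /leg_morphism.
  have -> : relabel (fun _ => 0) id id = 0 :> 'M[L]_r.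
    by apply/matrixP=> a b; rewrite !mxE if_same.
  have [ij|/gj->] := eqVneq i j; last first.
    by split=> [|n _]; rewrite ?mulmx0 ?mul0mx.
  case: _ / ij; rewrite gi; split=> [|n _]; last exact: endo.
  by rewrite src mul0mx.
- by exists (leg_vertex i (Ordinal ms)); rewrite /= gi.
- exists (inl r1); rewrite /= raddf0.
  by apply/eqP => /matrixP/(_ 0 0)/eqP; rewrite !mxE eqxx eq_sym oner_eq0.
Qed.

Lemma leg_vanish i m : (s i < m)%N -> d i m = 0%N.
Proof. by move=> H; apply: leg_dim_oversize; rewrite mu_size. Qed.

Lemma nsplit_leg_free A i m : (forall E, ~ qrep_split A E) -> row_free (leg_mx A i m).
Proof.
move=> nsplit; apply: contraT => nfree.
have [e [ch e0 ex]] := kernel_split (@leg_vanish i) nfree.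
by have [|E /nsplit] := leg_split_rep ch _ ex; rewrite ?e0 ?mulmx0.
Qed.

(** If the source map is not surjective, a nonzero covector vanishes on its image, and the
    idempotent built from it is killed by the source map. *)
Lemma nsplit_source_full A i :
  (forall E, ~ qrep_split A E) -> row_free (source_mx A i)^T.
Proof.
move=> nsplit; apply: contraT; rewrite -kermx_eq0 => /rowV0Pn[v /sub_kermxP vA v0].
have v0' : v^T != 0 by rewrite trmx_eq0.
have [e [u [ch e0 uv]]] := covector_split (leg_mx A i) (@leg_vanish i) v0'.
have src : source_mx A i *m e 0%N = 0.
  rewrite e0 mulmxA; suff -> : source_mx A i *m v^T = 0 by rewrite mul0mx.
  by apply: trmx_inj; rewrite trmx_mul trmxK vA trmx0.
have e_neq0 : exists m, e m != 0.
  exists 0%N; rewrite e0; apply: contraNneq v0' => vu.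
  by rewrite -[v^T]mulmx1 -uv mulmxA vu mul0mx.
by have [E /nsplit] := leg_split_rep ch src e_neq0.
Qed.

End Morphisms.

(** * Normal representations: endomorphisms and isomorphisms *)

Section NormalRep.
Variable L : fieldType.
Implicit Types (x : 'I_r * 'I_r * 'I_k -> L) (w : 'I_k -> {perm 'I_r}).

Definition colour x i p p' := x (p, p', i).

Definition normal_rep w x : qrep dim L := fun a =>
  match a return 'M[L]_(dim (sn_src a), dim (sn_tgt a)) with
  | inl (l, i) => row l (nf_source (mu_r i) (colour x i) (w i))
  | inr (existT i j) => nf_leg (mu_r i) (colour x i) (w i) j
  end.

Lemma source_normal_rep w x i :
  source_mx (normal_rep w x) i = nf_source (mu_r i) (colour x i) (w i).
Proof. by apply/matrixP=> l c; rewrite mxE /= mxE. Qed.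

Lemma leg_normal_rep w x i m : (m < s i)%N ->
  leg_mx (normal_rep w x) i m = nf_leg (mu_r i) (colour x i) (w i) m.
Proof. by move=> ms; rewrite (leg_mxE _ (Ordinal ms)). Qed.

Lemma normal_rep_leg_morphism w w' x x' i t g :
  leg_morphism (source_mx (normal_rep w x) i) (source_mx (normal_rep w' x') i)
    (leg_mx (normal_rep w x) i) (leg_mx (normal_rep w' x') i) t g <->
  leg_morphism (nf_source (mu_r i) (colour x i) (w i))
    (nf_source (mu_r i) (colour x' i) (w' i))
    (nf_leg (mu_r i) (colour x i) (w i)) (nf_leg (mu_r i) (colour x' i) (w' i)) t g.
Proof.
rewrite /leg_morphism !source_normal_rep sE.
by split=> -[H0 HS]; split=> // m ms; have := HS m ms; rewrite !leg_normal_rep.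
Qed.

Definition inversion_supported w x : Prop :=
  forall p p' i, x (p, p', i) != 0 -> (p < p')%N && (w i p' < w i p)%N.

(** By rigidity [E] is given by its scalars [t] on the sources, which agree along every edge of the
    support. Idempotency makes them 0 or 1, so connectivity is needed only for Boolean functions;
    [E] is then a scalar, 0 or 1. *)
Lemma normal_rep_nsplit w x E :
  (forall i, w i \in Sperm r (mutilde r (mu i))) -> inversion_supported w x ->
  (forall t : 'I_r -> bool,
     (forall p p' i, x (p, p', i) != 0 -> t p = t p') -> forall l l', t l = t l') ->
  ~ qrep_split (normal_rep w x) E.
Proof.
move=> Sw inv conn [idem endo [v Ev] [v' Ev']].
pose t := source_part E.
have legs i := (normal_rep_leg_morphism w w x x _ _).1 (morphism_parts endo i).
have rigid i := leg_rigid (fun m _ p => erefl) (legs i).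
have edge p p' i : x (p, p', i) != 0 -> t p = t p'.
  move=> xe; have /andP[pp' ww] := inv _ _ _ xe.
  have [_ rel0 relS] := rigid i.
  case: (inversion_level (mu_nil i) (mu_r i) (Sw i) pp' ww) => [H|[m ms /andP[H1 H2]]].
    have := rel0 _ _ H; rewrite mulrC; apply: mulIf.
    by rewrite inverse_weights_neq0.
  have := relS m p p' _ H1 H2; rewrite mulrC => /(_ _)/mulIf; apply=> //.
  by rewrite sE -ltnS -mu_size.
have t01 l : (t l == 0) || (t l == 1).
  have /matrixP/(_ 0 0) := idem (inl l); rewrite mxE big_ord1.
  move/eqP; rewrite -subr_eq0 -{3}[(E (inl l) : 'M_1) 0 0]mulr1 -mulrBr mulf_eq0.
  by rewrite subr_eq0.
have tE l : t l = t r1.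
  have /(_ l r1) : forall l l', (t l == 0) = (t l' == 0).
    by apply: (conn (fun l => t l == 0)) => p p' i /edge->.
  have := t01 l; have := t01 r1.
  case: (t l =P 0) => [->|_]; case: (t r1 =P 0) => [->|_] //=.
  by move=> /eqP-> /eqP->.
have Es u : E u = (t r1)%:M.
  case: u => [l|[i j]].
    by apply/matrixP=> a b; rewrite !ord1 mxE eqxx -(tE l).
  rewrite -leg_partE; have [gE _ _] := rigid i.
  rewrite gE; last by rewrite sE -ltnS.
  rewrite -(relabel_id _ (@pos_inj _ _ (mu_r i) (w i) j)).
  by apply/matrixP=> a b; rewrite !mxE -/t tE.
case/orP: (t01 r1) => /eqP t1.
  by move: Ev; rewrite Es t1 raddf0 eqxx.
by move: Ev'; rewrite Es t1 eqxx.
Qed.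

Lemma normal_rep_twist w x x' (t : 'I_r -> L) :
  (forall l, t l != 0) ->
  (forall p p' i, x (p, p', i) * t p = t p' * x' (p, p', i)) ->
  qrep_iso (normal_rep w x) (normal_rep w x').
Proof.
move=> t0 H; exists (family t (fun i m => relabel t (@pos _ _ (mu_r i) (w i) m)
                                                   (@pos _ _ (mu_r i) (w i) m))); split.
  move=> [l|[i j]] /=; first by rewrite unitmxE det_scalar1 unitfE.
  by apply: relabel_unit => //; apply: pos_inj.
apply: family_morphism => i; apply/normal_rep_leg_morphism; apply: leg_twist.
  move=> p p'; rewrite /inverse_weights /colour.
  have -> : x' (p, p', i) = (t p')^-1 * (x (p, p', i) * t p) by rewrite H mulKf.
  by rewrite !invfM invrK -!mulrA mulVf // mulr1.
by move=> p p'; apply: H.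
Qed.

(** The indicator function of [S], used as [t], respects every edge and gives the idempotent. *)
Lemma normal_rep_disconnected w x (S : {set 'I_r}) :
  (forall p p' i, x (p, p', i) != 0 -> (p \in S) = (p' \in S)) ->
  (exists l, l \in S) -> (exists l, l \notin S) ->
  exists E, qrep_split (normal_rep w x) E.
Proof.
move=> xS [l lS] [l' l'S]; pose t p : L := (p \in S)%:R.
have comm p p' i : x (p, p', i) * t p = t p' * x (p, p', i).
  have [->|/xS E] := eqVneq (x (p, p', i)) 0; first by rewrite mulr0 mul0r.
  by rewrite /t E mulrC.
exists (family t (fun i m => relabel t (@pos _ _ (mu_r i) (w i) m)
                                      (@pos _ _ (mu_r i) (w i) m))); split.
- move=> [p|[i j]] /=.
    by rewrite -scalar_mxM /t; case: (p \in S); rewrite ?mulr1 ?mulr0.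
  apply/matrixP=> c c'; rewrite (mul_relabel_l _ _ _ (@pos_inj _ _ _ _ _) erefl) mxE.
  by case: eqP; rewrite ?mulr0 // /t; case: (_ \in S); rewrite ?mulr1 ?mulr0.
- apply: family_morphism => i; apply/normal_rep_leg_morphism; apply: leg_twist => p p'.
    rewrite /inverse_weights /colour.
    have [->|/xS E] := eqVneq (x (p, p', i)) 0; first by rewrite invr0 mulr0 mul0r.
    by rewrite /t E mulrC.
  exact: comm.
- exists (inl l); rewrite /= /t lS.
  by apply/eqP => /matrixP/(_ 0 0)/eqP; rewrite !mxE eqxx oner_eq0.
- exists (inl l'); rewrite /= /t (negPf l'S).
  by apply/eqP => /matrixP/(_ 0 0)/eqP; rewrite !mxE eqxx eq_sym oner_eq0.
Qed.

Lemma normal_rep_iso_inj w w' x x' :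
  (forall i, w i \in Sperm r (mutilde r (mu i))) ->
  (forall i, w' i \in Sperm r (mutilde r (mu i))) ->
  inversion_supported w x -> inversion_supported w' x' ->
  qrep_iso (normal_rep w x) (normal_rep w' x') ->
  w =1 w' /\ exists t : 'I_r -> L, (forall l, t l != 0) /\
    forall p p' i, x (p, p', i) * t p = t p' * x' (p, p', i).
Proof.
move=> Sw Sw' inv inv' [E [Eu endo]]; pose t := source_part E.
have t0 l : t l != 0.
  by have := Eu (inl l); rewrite unitmxE det_mx11 unitfE.
have legs i := (normal_rep_leg_morphism w w' x x' _ _).1 (morphism_parts endo i).
have lev i : forall m, (m <= (size (mu i)).-1)%N ->
    codom (@pos _ _ (mu_r i) (w i) m) =i codom (@pos _ _ (mu_r i) (w' i) m).
  apply: (leg_levels t0 _ _ _ (legs i)).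
  - move=> m; rewrite sE -ltnS => ms; rewrite (leg_partE E (Ordinal ms)).
    exact: (Eu (leg_vertex i (Ordinal ms))).
  - by move=> p p' /inv/andP[].
  - by move=> p p' /inv'/andP[].
have ww i : w i = w' i.
  apply: (Sperm_levels_inj (mu_nil i) (mu_r i) (Sw i) (Sw' i)) => m p ms.
  by rewrite -!(codom_pos (mu_r i)) lev // -ltnS prednK.
split=> //; exists t; split=> // p p' i.
have [_ rel0 relS] := leg_rigid (lev i) (legs i).
(* Rigidity speaks only of free entries, that is, inversions; on all other pairs both weights
   vanish. *)
have [x0|] := boolP ((p < p')%N && (w i p' < w i p)%N); last first.
  move=> n; have -> : x (p, p', i) = 0 by apply/eqP; apply: contraNT n => /inv.
  suff -> : x' (p, p', i) = 0 by rewrite mul0r mulr0.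
  by apply/eqP; apply: contraNT n => /inv'; rewrite ww.
have /andP[pp' lt] := x0.
case: (inversion_level (mu_nil i) (mu_r i) (Sw i) pp' lt) => [H|[m ms /andP[H1 H2]]].
  have := rel0 _ _ H; rewrite /inverse_weights /colour -/t => /(congr1 GRing.inv).
  rewrite !invfM !invrK => E1.
  by rewrite -[x' _](divfK (t0 p)) E1 -mulrA mulVKf.
by apply: (relS m) => //; rewrite sE -ltnS -mu_size.
Qed.

End NormalRep.

(** The legs are normalised independently: each is brought to normal form with [t = 1], leaving the
    common sources untouched. *)
Lemma normal_rep_exists (L : fieldType) (A : qrep dim L) :
  (forall E, ~ qrep_split A E) ->
  exists (w : {ffun 'I_k -> {perm 'I_r}}) (x : {ffun 'I_r * 'I_r * 'I_k -> L}),
    [/\ forall i, w i \in Sperm r (mutilde r (mu i)), inversion_supported w x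
      & qrep_iso A (normal_rep w x)].
Proof.
move=> nsplit.
have leg i := leg_normalizable r0 (mu_nil i) (mu_r i) (nsplit_source_full i nsplit)
  (fun m _ => nsplit_leg_free i m nsplit).
have [w0 legw] := fin_all_exists leg; pose w := finfun w0.
have /fin_all_exists[x /fin_all_exists[g H]] :
    forall i, exists (x : 'I_r -> 'I_r -> L) (g : forall m, 'M[L]_(d i m)),
    [/\ w i \in Sperm r (mutilde r (mu i)),
        forall p p', x p p' != 0 -> (p < p')%N && (w i p' < w i p)%N,
        forall m, (m <= (size (mu i)).-1)%N -> g m \in unitmx
      & leg_morphism (source_mx A i) (nf_source (mu_r i) x (w i)) (leg_mx A i)
          (nf_leg (mu_r i) x (w i)) (fun _ => 1) g].
  by move=> i; rewrite ffunE.
pose y e := x e.2 e.1.1 e.1.2; exists w, (finfun y); split=> [i|p p' i|].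
- by have [] := H i.
- by rewrite ffunE; have [_ inv _ _] := H i => /inv.
apply: (@qrep_iso_trans _ _ _ _ (normal_rep w y)); last first.
  apply: (@normal_rep_twist _ _ _ _ (fun _ => 1)) => [l|p p' i].
    exact: oner_neq0.
  by rewrite ffunE mulr1 mul1r.
exists (family (fun _ => 1) g); split.
  move=> [l|[i j]] /=; first exact: unitmx1.
  by have [_ _ gu _] := H i; apply: gu; rewrite sE -ltnS.
apply: family_morphism => i; have [_ _ _ [E0 ES]] := H i.
rewrite /leg_morphism source_normal_rep; split=> // m; rewrite sE => ms.
by rewrite leg_normal_rep // ES ?sE.
Qed.

(** Extending scalars replaces [x] by [f \o x], which has the same support because [f] is injective,
    so the argument against idempotents applies over each [L]. *)
Lemma normal_rep_abs_indecomposable (F : fieldType) w (x : 'I_r * 'I_r * 'I_k -> F) :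
  (forall i, w i \in Sperm r (mutilde r (mu i))) -> inversion_supported w x ->
  connected_spanning [set e | x e != 0] ->
  qrep_abs_indecomposable (normal_rep w x).
Proof.
move=> Sw inv conn L f; split; first by exists (inl r1).
case/decomposable_split=> E [idem endo E0 E1].
have mapE a : map_mx f (normal_rep w x a) = normal_rep w (f \o x) a.
  have map_nf (n m : nat) z z' (phi : 'I_n -> 'I_r) (psi : 'I_m -> 'I_r) :
      (forall p p', f (z p p') = z' p p') -> map_mx f (nf z phi psi) = nf z' phi psi.
    move=> zz'; apply/matrixP=> c c'; rewrite !mxE (fun_if f) zz'.
    by rewrite rmorph_nat.
  case: a => [[l i]|[i j]] /=; last exact: map_nf.
  rewrite map_row /nf_source -map_trmx; congr (row _ (_^T)); apply: map_nf => p p'.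
  exact: fmorphV.
apply: (@normal_rep_nsplit L w (f \o x) E) => //.
- by move=> p p' i /=; rewrite fmorph_eq0 => /inv.
- move=> t tE; apply: (connected_constant conn) => -[[p p'] i]; rewrite inE => xe.
  by apply: (tE _ _ i); rewrite /= fmorph_eq0.
- by split=> // a; rewrite -mapE endo.
Qed.

Lemma supernova_count (F : finFieldType) :
  num_abs_indec_classes dim F
    (\sum_(w : {ffun 'I_k -> {perm 'I_r}} |
             [forall i : 'I_k, w i \in Sperm r (mutilde r (mu i))]) Rw w #|F|).
Proof.
set P := fun w : {ffun 'I_k -> {perm 'I_r}} =>
  [forall i : 'I_k, w i \in Sperm r (mutilde r (mu i))].
have dataP z : z \in normal_data F P -> [/\ forall i, z.1 i \in Sperm r (mutilde r (mu i)),
    inversion_supported z.1 z.2 & connected_spanning (wsupp z.2)].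
  rewrite inE => /and3P[/forallP Pw /subsetP sub conn]; split=> // p p' i xe.
  by have := sub (p, p', i); rewrite !inE => ->.
have [z [zD z_inj z_surj]] := normal_data_transversal F r0 P.
exists (fun i => normal_rep (z i).1 (z i).2); split; [|split].
- by move=> i; have [] := dataP _ (zD i); apply: normal_rep_abs_indecomposable.
- move=> i j iso; apply: z_inj.
  have [Si inv_i _] := dataP _ (zD i); have [Sj inv_j _] := dataP _ (zD j).
  have [ww [t [t0 tE]]] := normal_rep_iso_inj Si Sj inv_i inv_j iso.
  apply/andP; split; first by apply/eqP/ffunP.
  apply/existsP; exists (finfun t); apply/torus_relatedP; split=> [l|[[p p'] c]].
    by rewrite ffunE.
  by rewrite !ffunE tE.
move=> A absA.
have nsplit E : ~ qrep_split A E := abs_indecomposable_nsplit absA.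
have [w [x [Sw inv iso]]] := normal_rep_exists nsplit.
have yD : (w, x) \in normal_data F P.
  rewrite inE; apply/and3P; split; first exact/forallP.
    apply/subsetP=> -[[p p'] i]; rewrite !inE; exact: inv.
  (* A disconnected support would split the normal form over [F] itself, and the isomorphism would
     carry the idempotent to [A]. *)
  apply: contraT => /disconnected_set[S [SE inS notinS]].
  have [p p' i xe|E splitE] := @normal_rep_disconnected F w x S _ inS notinS.
    by apply: (SE (p, p', i)); rewrite inE.
  by have [E' /nsplit] := split_iso iso splitE.
have [i /andP[/eqP wE /existsP[t /torus_relatedP[t0 tE]]]] := z_surj _ yD.
exists i; apply: qrep_iso_trans iso _; rewrite -wE.
by apply: (@normal_rep_twist _ _ _ _ t) => // p p' c; apply: (tE (p, p', c)).
Qed.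

End Supernova.

Theorem theorem3p14 (r k : nat) (s : 'I_k -> nat) (mu : 'I_k -> seq nat)
  (hr : (0 < r)%N) (hk : (0 < k)%N)
  (hsize : forall i, size (mu i) = (s i).+1)
  (hpart : forall i, sorted geq (mu i))
  (hnz : forall i, (0 < sumn (mu i))%N)
  (hr_ge : forall i, (sumn (mu i) + head 0%N (mu i) <= r)%N) :
  forall F : finFieldType,
    num_abs_indec_classes (@sn_dim r k s mu) F
      (\sum_(w : {ffun 'I_k -> {perm 'I_r}} |
               [forall i : 'I_k, w i \in Sperm r (mutilde r (mu i))])
          Rw w #|F|).
Proof.
move=> F; apply: supernova_count => // i.
exact: leq_trans (leq_addr _ _) (hr_ge i).
Qed.
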